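(* Let $V$ be a non-zero module in $\mathscr O^{int}_q(\mathfrak g)$ and let $J(V)=\{i\in I : F_i(V)=\{0\}\}$. Then the assignments $$\sigma^i_V\mapsto \begin{cases}1,& i\in J(V),\\ s_i,&\text{otherwise,}\end{cases}\qquad i\in I,$$ define a homomorphism of groups $\psi_V:\mathsf W(V)\to W$, where $\mathsf W(V)$ is the subgroup of $\mathrm{GL}_{\Bbbk}(V)$ generated by the $\sigma^i_V$, $i\in I$, and $W$ is the Weyl group of $\mathfrak g$.
   Context: Root data. $I$ is a finite set, $A=(a_{ij})_{i,j\in I}$ a symmetrizable generalized Cartan matrix, $\mathfrak h$ a finite-dimensional complex vector space, $\{\alpha_i\}_{i\in I}\subset\mathfrak h^*$, $\{\alpha_i^\vee\}_{i\in I}\subset\mathfrak h$ linearly independent subsets, $(\cdot,\cdot)$ a symmetric non-degenerate bilinear form on $\mathfrak h^*$, $P\subset\mathfrak h^*$ a lattice of rank $\dim\mathfrak h^*$, such that $\alpha_j(\alpha_i^\vee)=a_{ij}$, $(\alpha_i,\alpha_i)\in 2\mathbb Z_{>0}$, $\lambda(\alpha_i^\vee)=2(\lambda,\alpha_i)/(\alpha_i,\alpha_i)$ for $\lambda\in\mathfrak h^*$, $\alpha_i\in P$, $\lambda(\alpha_i^\vee)\in\mathbb Z$ for $\lambda\in P$, and $(P,P)\subset\frac1d\mathbb Z$ for some $d\in\mathbb Z_{>0}$. The $\omega_i\in\mathfrak h^*$ defined by $\omega_i(\alpha_j^\vee)=\delta_{ij}$ and $\omega_i(h)=0$ for $h\in\bigcap_{j}\ker\alpha_j$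 are assumed to lie in $P$. $Q^+=\sum_i\mathbb Z_{\ge0}\alpha_i$. $\mathfrak g$ is the Kac-Moody algebra attached to these data. The Weyl group $W$ is generated by the simple reflections $s_i$, $s_i\lambda=\lambda-\lambda(\alpha_i^\vee)\alpha_i$ on $\mathfrak h^*$. Quantum group. $\Bbbk$ is a field of characteristic zero containing an element $q^{1/(2d)}$ transcendental over $\mathbb Q$; $q_i=q^{(\alpha_i,\alpha_i)/2}$; $(n)_v=\frac{v^n-v^{-n}}{v-v^{-1}}$, $(n)_v!=\prod_{s=1}^n(s)_v$, $X_i^{(n)}=X_i^n/(n)_{q_i}!$. $U_q(\mathfrak g)$ is the $\Bbbk$-algebra generated by $E_i,F_i$ ($i\in I$), $K_\lambda$ ($\lambda\in\frac12P$, $K_\lambda K_\mu=K_{\lambda+\mu}$, $K_0=1$) with relations $K_\lambda E_i=q^{(\lambda,\alpha_i)}E_iK_\lambda$, $K_\lambda F_i=q^{-(\lambda,\alpha_i)}F_iK_\lambda$, $[E_i,F_j]=\delta_{ij}\frac{K_{\alpha_i}-K_{-\alpha_i}}{q_i-q_i^{-1}}$ and the quantum Serre relations $\sum_{r+s=1-a_{ij}}(-1)^rE_i^{(r)}E_jE_i^{(s)}=0=\sum_{r+s=1-a_{ij}}(-1)^rF_i^{(r)}F_jF_i^{(s)}$, $i\ne j$. $U_q^{+}(\mathfrak g)$ is the subalgebra generated by the $E_i$, graded by $Q^+$ with $\deg E_i=\alpha_i$. Category. $\mathscr O^{int}_q(\mathfrak g)$ is the full subcategory of $U_q(\mathfrak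 g)$-modules $M$ such that $M=\bigoplus_{\beta\in P}M(\beta)$, $M(\beta)=\{m:K_\lambda(m)=q^{(\lambda,\beta)}m\ \forall\lambda\in\frac12P\}$, all $E_i,F_i$ act locally nilpotently, and for each $m\in M$ there is $N(m)\ge0$ with $U_q^+(\mathfrak g)(\nu)(m)=0$ for every $\nu=\sum n_i\alpha_i\in Q^+$ with $\sum n_i\ge N(m)$. Operators $\sigma^i_V$. For $V\in\mathscr O^{int}_q(\mathfrak g)$, $i\in I$, $\sigma^i_V$ is the unique $\Bbbk$-linear operator on $V$ with $\sigma^i_V(E_i^{(k)}(u))=E_i^{(l-k)}(u)$ for all $l\ge k\ge0$ and all $u\in\ker F_i\cap\ker(K_{\alpha_i}-q_i^{-l})$. It is an involution. *)

(* Defs.v *)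
From HB Require Import structures.
From mathcomp Require Import all_boot all_order all_algebra.
From mathcomp Require Import all_classical reals.
From mathcomp Require Export complex.

Set Implicit Arguments.
Unset Strict Implicit.
Unset Printing Implicit Defensive.

Import Order.TTheory GRing.Theory Num.Theory.
Local Open Scope quotient_scope.
Local Open Scope classical_set_scope.
Local Open Scope ring_scope.

Section Expressions.
Variables (k : Type) (X : Type).

Inductive expr : Type :=
| Gen of X
| Cst of k
| Add of expr & expr
| Mul of expr & expr.

HB.instance Definition _ := gen_eqMixin expr.
HB.instance Definition _ := gen_choiceMixin expr.

End Expressions.

Arguments Gen {k X}.
Arguments Cst {k X}.

Declare Scope expr_scope.
Delimit Scope expr_scope with expr.
Bind Scope expr_scope with expr.
Notation "x + y" := (Add x y) : expr_scope.
Notation "x * y" := (Mul x y) : expr_scope.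
Notation "x - y" := (Add x (Mul (Cst (-1)) y)) : expr_scope.
Notation "c *: x" := (Mul (Cst c) x) : expr_scope.
Notation "x ^+ n" := (iter n (Mul x) (Cst 1)) : expr_scope.
Notation "1" := (Cst 1) : expr_scope.
Notation "0" := (Cst 0) : expr_scope.

Section PresentedAlgebra.
Variables (k : comPzRingType) (X : Type).
Variable rel : expr k X -> expr k X -> Prop.

(* The least congruence containing [rel] whose quotient is a [k]-algebra. *)
Inductive pres_cong : expr k X -> expr k X -> Prop :=
| pc_rel x y : rel x y -> pres_cong x y
| pc_refl x : pres_cong x x
| pc_sym x y : pres_cong x y -> pres_cong y x
| pc_trans x y z : pres_cong x y -> pres_cong y z -> pres_cong x z
| pc_add x x' y y' :
    pres_cong x x' -> pres_cong y y' -> pres_cong (x + y) (x' + y')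
| pc_mul x x' y y' :
    pres_cong x x' -> pres_cong y y' -> pres_cong (x * y) (x' * y')
| pc_addA x y z : pres_cong (x + (y + z)) (x + y + z)
| pc_addC x y : pres_cong (x + y) (y + x)
| pc_add0 x : pres_cong (0 + x) x
| pc_mulA x y z : pres_cong (x * (y * z)) (x * y * z)
| pc_mul1 x : pres_cong (1 * x) x
| pc_mul0 x : pres_cong (0 * x) 0
| pc_mulDl x y z : pres_cong ((x + y) * z) (x * z + y * z)
| pc_mulDr x y z : pres_cong (x * (y + z)) (x * y + x * z)
| pc_cstD c d : pres_cong (Cst (c + d)%R) (Cst c + Cst d)
| pc_cstM c d : pres_cong (Cst (c * d)%R) (Cst c * Cst d)
| pc_cstC c x : pres_cong (Cst c * x) (x * Cst c).

Definition pres_eq (x y : expr k X) : bool := `[< pres_cong x y >].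

Lemma pres_eq_refl : reflexive pres_eq.
Proof. by move=> x; apply/asboolP; apply: pc_refl. Qed.

Lemma pres_eq_sym : symmetric pres_eq.
Proof. by move=> x y; apply/asboolP/asboolP; apply: pc_sym. Qed.

Lemma pres_eq_trans : transitive pres_eq.
Proof.
by move=> y x z /asboolP xy /asboolP yz; apply/asboolP; apply: pc_trans yz.
Qed.

Canonical pres_equiv :=
  EquivRel pres_eq pres_eq_refl pres_eq_sym pres_eq_trans.

Definition pres_alg : Type := {eq_quot pres_equiv}.

HB.instance Definition _ := Choice.on pres_alg.
HB.instance Definition _ := EqQuotient.on pres_alg.

Definition pcls (x : expr k X) : pres_alg := \pi_pres_alg x.

Lemma pcls_eq x y : pcls x = pcls y <-> pres_cong x y.
Proof. by split=> [/eqmodP/asboolP|xy] //; apply/eqmodP/asboolP. Qed.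

Lemma pclsK (a : pres_alg) : pcls (repr a) = a. Proof. exact: reprK. Qed.

Lemma pres_cong_repr x : pres_cong (repr (pcls x)) x.
Proof. by apply/pcls_eq; rewrite pclsK. Qed.

Definition pres_add (a b : pres_alg) := pcls (repr a + repr b).
Definition pres_mul (a b : pres_alg) := pcls (repr a * repr b).
Definition pres_cst (c : k) : pres_alg := pcls (Cst c).
Definition pres_gen (x : X) : pres_alg := pcls (Gen x).

Lemma pcls_add x y : pcls (x + y) = pres_add (pcls x) (pcls y).
Proof. by apply/pcls_eq/pc_add; apply/pc_sym/pres_cong_repr. Qed.

Lemma pcls_mul x y : pcls (x * y) = pres_mul (pcls x) (pcls y).
Proof. by apply/pcls_eq/pc_mul; apply/pc_sym/pres_cong_repr. Qed.

Lemma pcls_ind (P : pres_alg -> Prop) : (forall x, P (pcls x)) -> forall a, P a.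
Proof. by move=> Px a; rewrite -(pclsK a). Qed.

Lemma pres_addA : associative pres_add.
Proof.
elim/pcls_ind=> x; elim/pcls_ind=> y; elim/pcls_ind=> z.
by rewrite -!pcls_add; apply/pcls_eq/pc_addA.
Qed.

Lemma pres_addC : commutative pres_add.
Proof.
elim/pcls_ind=> x; elim/pcls_ind=> y.
by rewrite -!pcls_add; apply/pcls_eq/pc_addC.
Qed.

Lemma pres_add0 : left_id (pres_cst 0) pres_add.
Proof. by elim/pcls_ind=> x; rewrite -pcls_add; apply/pcls_eq/pc_add0. Qed.

Lemma pres_mul1 : left_id (pres_cst 1) pres_mul.
Proof. by elim/pcls_ind=> x; rewrite -pcls_mul; apply/pcls_eq/pc_mul1. Qed.

Lemma pres_cstC c a : pres_mul (pres_cst c) a = pres_mul a (pres_cst c).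
Proof.
by elim/pcls_ind: a => x; rewrite -!pcls_mul; apply/pcls_eq/pc_cstC.
Qed.

Lemma pres_mul1r : right_id (pres_cst 1) pres_mul.
Proof. by move=> a; rewrite -pres_cstC pres_mul1. Qed.

Lemma pres_mulA : associative pres_mul.
Proof.
elim/pcls_ind=> x; elim/pcls_ind=> y; elim/pcls_ind=> z.
by rewrite -!pcls_mul; apply/pcls_eq/pc_mulA.
Qed.

Lemma pres_mulDl : left_distributive pres_mul pres_add.
Proof.
elim/pcls_ind=> x; elim/pcls_ind=> y; elim/pcls_ind=> z.
by rewrite -!(pcls_mul, pcls_add); apply/pcls_eq/pc_mulDl.
Qed.

Lemma pres_mulDr : right_distributive pres_mul pres_add.
Proof.
elim/pcls_ind=> x; elim/pcls_ind=> y; elim/pcls_ind=> z.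
by rewrite -!(pcls_mul, pcls_add); apply/pcls_eq/pc_mulDr.
Qed.

Lemma pres_cstD c d : pres_cst (c + d) = pres_add (pres_cst c) (pres_cst d).
Proof. by rewrite -pcls_add; apply/pcls_eq/pc_cstD. Qed.

Lemma pres_cstM c d : pres_cst (c * d) = pres_mul (pres_cst c) (pres_cst d).
Proof. by rewrite -pcls_mul; apply/pcls_eq/pc_cstM. Qed.

Definition pres_opp a := pres_mul (pres_cst (-1)) a.

Lemma pres_addN : left_inverse (pres_cst 0) pres_opp pres_add.
Proof.
move=> a; rewrite -[X in pres_add _ X]pres_mul1 -pres_mulDl -pres_cstD addNr.
by elim/pcls_ind: a => x; rewrite -pcls_mul; apply/pcls_eq/pc_mul0.
Qed.

HB.instance Definition _ :=
  GRing.isZmodule.Build pres_alg pres_addA pres_addC pres_add0 pres_addN.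

HB.instance Definition _ :=
  GRing.Zmodule_isPzRing.Build pres_alg
    pres_mulA pres_mul1 pres_mul1r pres_mulDl pres_mulDr.

Definition pres_scale (c : k) (a : pres_alg) : pres_alg := pres_cst c * a.

Lemma pres_scaleA c d a :
  pres_scale c (pres_scale d a) = pres_scale (c * d) a.
Proof. by rewrite /pres_scale mulrA [in RHS]pres_cstM. Qed.

Lemma pres_scale1 : left_id 1 pres_scale.
Proof. by move=> a; apply: mul1r. Qed.

Lemma pres_scaleDr : right_distributive pres_scale +%R.
Proof. by move=> c a b; apply: mulrDr. Qed.

Lemma pres_scaleDl a : {morph pres_scale^~ a : c d / c + d}.
Proof. by move=> c d; rewrite /pres_scale pres_cstD; apply: mulrDl. Qed.

HB.instance Definition _ :=
  GRing.Zmodule_isLmodule.Build k pres_alg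
    pres_scaleA pres_scale1 pres_scaleDr pres_scaleDl.

Lemma pres_scaleAl (c : k) (a b : pres_alg) : c *: (a * b) = c *: a * b.
Proof. exact: mulrA. Qed.

Lemma pres_scaleAr (c : k) (a b : pres_alg) : c *: (a * b) = a * (c *: b).
Proof.
rewrite {1}/GRing.scale /= /pres_scale mulrA.
by rewrite [pres_cst c * a]pres_cstC -mulrA.
Qed.

End PresentedAlgebra.

Section GL.
Variables (K : pzRingType) (V : lmodType K).

Record GL := MkGL {
  GL_fun :> V -> V;
  _ : `[< linear GL_fun /\ bijective GL_fun >] }.

HB.instance Definition _ := [isSub for GL_fun].
HB.instance Definition _ := [Choice of GL by <:].

Lemma GL_linear (f : GL) : linear f.
Proof. by case: f => f /= /asboolP[]. Qed.

Lemma GL_bij (f : GL) : bijective f.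
Proof. by case: f => f /= /asboolP[]. Qed.

Lemma GL_eq (f g : GL) : f =1 g -> f = g.
Proof. by move=> fg; apply/val_inj/funext. Qed.

Lemma GL_one_subproof :
  `[< linear (@idfun V) /\ bijective (@idfun V) >].
Proof. by apply/asboolP; split=> //; exists idfun. Qed.
Definition GL_one := MkGL GL_one_subproof.

Lemma GL_mul_subproof (f g : GL) :
  `[< linear (f \o g) /\ bijective (f \o g) >].
Proof.
apply/asboolP; split; last exact: bij_comp (GL_bij f) (GL_bij g).
by move=> a u v /=; rewrite !GL_linear.
Qed.
Definition GL_mul f g := MkGL (GL_mul_subproof f g).

Definition GL_inv_fun (f : GL) (v : V) : V := xget 0 [set u | f u = v].

Lemma GL_inv_funK (f : GL) : cancel (GL_inv_fun f) f.
Proof.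
move=> v; have [g _ gK] := GL_bij f.
by apply: (@xgetPex _ 0 [set u | f u = v]); exists (g v); apply: gK.
Qed.

Lemma GL_funK (f : GL) : cancel f (GL_inv_fun f).
Proof. by move=> v; apply: (bij_inj (GL_bij f)); rewrite GL_inv_funK. Qed.

Lemma GL_inv_subproof (f : GL) :
  `[< linear (GL_inv_fun f) /\ bijective (GL_inv_fun f) >].
Proof.
apply/asboolP; split; last by exists f; [exact: GL_inv_funK|exact: GL_funK].
move=> a u v; apply: (bij_inj (GL_bij f)).
by rewrite GL_linear !GL_inv_funK.
Qed.
Definition GL_inv f := MkGL (GL_inv_subproof f).

Lemma GL_mulA : associative GL_mul.
Proof. by move=> f g h; apply: GL_eq. Qed.
Lemma GL_mul1 : left_id GL_one GL_mul.
Proof. by move=> f; apply: GL_eq. Qed.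
Lemma GL_mul1r : right_id GL_one GL_mul.
Proof. by move=> f; apply: GL_eq. Qed.
Lemma GL_mulV : left_inverse GL_one GL_inv GL_mul.
Proof. by move=> f; apply: GL_eq => v /=; rewrite GL_funK. Qed.
Lemma GL_mulVr : right_inverse GL_one GL_inv GL_mul.
Proof. by move=> f; apply: GL_eq => v /=; rewrite GL_inv_funK. Qed.

HB.instance Definition _ :=
  isGroup.Build GL GL_mulA GL_mul1 GL_mul1r GL_mulV GL_mulVr.

End GL.

Section Generated.
Variables (I : Type) (G : groupType) (s : I -> G).

Definition in_generated : pred G := fun x =>
  `[< forall H : set G, H 1%g -> (forall y z, H y -> H z -> H (y / z)%g) ->
        (forall i, H (s i)) -> H x >].

Lemma in_generated_closed : group_closed in_generated.
Proof.
split=> [|x y /asboolP Gx /asboolP Gy]; apply/asboolP => H H1 HF Hs //.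
by apply: (HF _ _ (Gx H H1 HF Hs) (Gy H H1 HF Hs)).
Qed.

Record generated := MkGenerated { generated_val :> G; _ : in_generated generated_val }.

HB.instance Definition _ := [isSub for generated_val].
HB.instance Definition _ := [Choice of generated by <:].
HB.instance Definition _ :=
  SubChoice_isSubGroup.Build G in_generated generated in_generated_closed.

Lemma generator_subproof i : in_generated (s i).
Proof. by apply/asboolP. Qed.

Definition generator i : generated := MkGenerated (generator_subproof i).

End Generated.

Record root_datum (C : numFieldType) (I : finType) := RootDatum {
  cartan : I -> I -> int;
  cartan_diag : forall i, cartan i i = 2;
  cartan_off : forall i j, i != j -> cartan i j <= 0;
  cartan_zero : forall i j, cartan i j = 0 -> cartan j i = 0;
  cartan_symmetrizable : exists D : I -> int,
    (forall i, 0 < D i) /\ (forall i j, D i * cartan i j = D j * cartan j i);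
  cartan_space : vectType C;
  simple_root : I -> 'Hom(cartan_space, C^o);
  simple_coroot : I -> cartan_space;
  root_form :
    'Hom(cartan_space, C^o) -> 'Hom(cartan_space, C^o) -> C;
  weight_lattice : set 'Hom(cartan_space, C^o);
  root_denom : nat;
  simple_root_free : free [seq simple_root i | i : I];
  simple_coroot_free : free [seq simple_coroot i | i : I];
  root_form_linear : forall mu, linear (fun lam => root_form lam mu : C^o);
  root_form_sym : forall lam mu, root_form lam mu = root_form mu lam;
  root_form_nondeg : forall lam, (forall mu, root_form lam mu = 0) -> lam = 0;
  weight_latticeP :
    exists b : (\dim (fullv : {vspace 'Hom(cartan_space, C^o)})).-tuple
                 'Hom(cartan_space, C^o),
      basis_of fullv b /\
      weight_lattice = [set lam | exists c, lam = \sum_i tnth b i *~ c i];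
  simple_root_coroot :
    forall i j, simple_root j (simple_coroot i) = (cartan i j)%:~R;
  root_form_simple : forall i,
    exists2 n : nat, (0 < n)%N & root_form (simple_root i) (simple_root i) =
                                 (2 * n)%:R;
  weight_coroot : forall (lam : 'Hom(cartan_space, C^o)) i,
    lam (simple_coroot i) =
    2 * root_form lam (simple_root i)
      / root_form (simple_root i) (simple_root i);
  simple_root_lattice : forall i, weight_lattice (simple_root i);
  weight_coroot_int : forall lam i, weight_lattice lam ->
    exists n : int, lam (simple_coroot i) = n%:~R;
  root_denom_gt0 : (0 < root_denom)%N;
  root_form_lattice : forall lam mu,
    weight_lattice lam -> weight_lattice mu ->
    exists n : int, root_denom%:R * root_form lam mu = n%:~R;
  fundamental_weight_lattice : forall i (omega : 'Hom(cartan_space, C^o)),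
    (forall j, omega (simple_coroot j) = (i == j)%:R) ->
    (forall h, (forall j, simple_root j h = 0) -> omega h = 0) ->
    weight_lattice omega
}.

Arguments weight_lattice {C I} r.

Section RootDatum.
Variables (C : numFieldType) (I : finType) (D : root_datum C I).

Definition dual_space := 'Hom(cartan_space D, C^o).
HB.instance Definition _ := Vector.on dual_space.

(* [lam] lies in [1/2 P]. *)
Definition in_half_lattice : pred dual_space :=
  fun lam => `[< weight_lattice D (lam *+ 2) >].

Lemma weight_lattice_zmod : zmod_closed (fun lam => `[< weight_lattice D lam >]).
Proof.
have [b [_ ->]] := weight_latticeP D.
split=> [|x y /asboolP[c ->] /asboolP[e ->]]; apply/asboolP.
  by exists (fun=> 0); rewrite big1.
exists (fun i => c i - e i); rewrite -sumrB.
by apply: eq_bigr => i _; rewrite mulrzBr.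
Qed.

Lemma half_lattice_zmod : zmod_closed in_half_lattice.
Proof.
have [P0 PB] := weight_lattice_zmod.
split=> [|x y Px Py]; rewrite /in_half_lattice unfold_in.
  by rewrite mul0rn.
by rewrite mulrnBl; apply: PB.
Qed.

Record half_lattice :=
  HalfLattice { half_val :> dual_space; _ : in_half_lattice half_val }.

HB.instance Definition _ := [isSub for half_val].
HB.instance Definition _ := [Choice of half_lattice by <:].
HB.instance Definition _ :=
  GRing.SubChoice_isSubZmodule.Build dual_space in_half_lattice half_lattice
    half_lattice_zmod.

Lemma half_root_subproof i : in_half_lattice (simple_root D i).
Proof.
have Pa : `[< weight_lattice D (simple_root D i) >].
  by apply/asboolP/simple_root_lattice.
have [_ PD] := GRing.zmod_closedD weight_lattice_zmod.
by rewrite /in_half_lattice mulr2n; apply: PD.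
Qed.
Definition half_root i : half_lattice := HalfLattice (half_root_subproof i).

Definition reflection_fun i (lam : dual_space) : dual_space :=
  lam - (lam (simple_coroot D i) : C) *: simple_root D i.

Lemma reflection_subproof i :
  `[< linear (reflection_fun i) /\ bijective (reflection_fun i) >].
Proof.
apply/asboolP; split=> [a u v|].
  rewrite /reflection_fun add_lfunE scale_lfunE scalerDl scalerBr !scalerA.
  by rewrite opprD addrACA.
have K : cancel (reflection_fun i) (reflection_fun i); last first.
  by exists (reflection_fun i).
move=> u; rewrite {1}/reflection_fun.
have -> : reflection_fun i u (simple_coroot D i) = - u (simple_coroot D i).
  rewrite /reflection_fun add_lfunE opp_lfunE scale_lfunE simple_root_coroot cartan_diag.
  by rewrite /GRing.scale /= mulr_natr mulr2n opprD addNKr.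
by rewrite scaleNr opprK subrK.
Qed.

Definition simple_reflection i : GL dual_space := MkGL (reflection_subproof i).

Definition weyl_group := generated simple_reflection.

End RootDatum.

(* [q_number v n] is [(n)_v], [q_fact v n] is [(n)_v !]. *)
Definition q_number (k : fieldType) (v : k) (n : nat) : k :=
  (v ^+ n - v ^- n) / (v - v^-1).

Definition q_fact (k : fieldType) (v : k) (n : nat) : k :=
  \prod_(1 <= s < n.+1) q_number v s.

(* Below, [qr] is the element [q^(1/(2d))] of the ground field, where [d] is  *)
(* [root_denom D].                                                            *)
Section QuantumGroup.
Variables (C : numFieldType) (I : finType) (D : root_datum C I).
Variables (k : fieldType) (qr : k).

(* [q^z] for [z] in [1/(2d) Z]; the exponent defaults to [0] elsewhere. *)
Definition q_pow (z : C) : k :=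
  qr ^ (xget 0 [set n : int | n%:~R = (2 * root_denom D)%:R * z]).

Definition q_simple (i : I) : k :=
  q_pow (root_form (simple_root D i) (simple_root D i) / 2).

Inductive Uq_gen : Type :=
| gen_E of I
| gen_F of I
| gen_K of half_lattice D.

Local Notation E i := (Gen (gen_E i)).
Local Notation F i := (Gen (gen_F i)).
Local Notation K lam := (Gen (gen_K lam)).

Definition expr_divp (i : I) (x : expr k Uq_gen) (n : nat) : expr k Uq_gen :=
  ((q_fact (q_simple i) n)^-1%R *: x ^+ n)%expr.

(* The sum over [r + s = 1 - a_ij] of [(-1)^r x^(r) y x^(s)]; note that        *)
(* [1 - a_ij >= 0] when [i != j].                                             *)
Definition expr_serre (i j : I) (x y : expr k Uq_gen) : expr k Uq_gen :=
  let m := `|1 - cartan D i j|%N in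
  (\big[@Add k Uq_gen / 0]_(r < m.+1)
     (((-1) ^+ r)%R *: (expr_divp i x r * y * expr_divp i x (m - r)%N)))%expr.

Inductive Uq_rel : expr k Uq_gen -> expr k Uq_gen -> Prop :=
| rel_KK lam mu : Uq_rel (K lam * K mu) (K (lam + mu)%R)
| rel_K0 : Uq_rel (K 0%R) 1
| rel_KE lam i :
    Uq_rel (K lam * E i)
           (q_pow (root_form (half_val lam) (simple_root D i)) *: (E i * K lam))
| rel_KF lam i :
    Uq_rel (K lam * F i)
           (q_pow (- root_form (half_val lam) (simple_root D i))%R
              *: (F i * K lam))
| rel_EF i j :
    Uq_rel (E i * F j - F j * E i)
           (if i == j then
              ((q_simple i - (q_simple i)^-1)^-1%R
                 *: (K (half_root D i) - K (- half_root D i)%R))%expr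
            else 0%expr)
| rel_serreE i j : i != j -> Uq_rel (expr_serre i j (E i) (E j)) 0
| rel_serreF i j : i != j -> Uq_rel (expr_serre i j (F i) (F j)) 0.

Definition Uq : Type := pres_alg Uq_rel.

(* [algType] requires a nonzero ring; the counit shows that [Uq] is one. *)
Fixpoint counit_expr (x : expr k Uq_gen) : k :=
  match x with
  | Gen (gen_K _) => 1
  | Gen _ => 0
  | Cst c => c
  | Add x y => counit_expr x + counit_expr y
  | Mul x y => counit_expr x * counit_expr y
  end.

Lemma counit_serre i j x y :
  counit_expr y = 0 -> counit_expr (expr_serre i j x y) = 0.
Proof.
move=> y0; rewrite /expr_serre.
apply: (@big_ind _ (fun z => counit_expr z = 0)) => [//|u v /= -> ->|r _ /=].
  by rewrite addr0.
by rewrite y0 !(mulr0, mul0r).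
Qed.

Lemma counit_rel x y : Uq_rel x y -> counit_expr x = counit_expr y.
Proof.
case=> [lam mu||lam i|lam i|i j|i j _|i j _] /=;
  rewrite ?counit_serre ?(mulr0, mul0r, mulr1, addr0, add0r)//.
by case: ifP => //= _; rewrite mulr1 subrr mulr0.
Qed.

Lemma counit_cong x y : pres_cong Uq_rel x y -> counit_expr x = counit_expr y.
Proof.
elim=> //=.
- exact: counit_rel.
- by move=> a b c _ -> _ ->.
- by move=> a a' b b' _ -> _ ->.
- by move=> a a' b b' _ -> _ ->.
- by move=> *; rewrite addrA.
- by move=> *; rewrite addrC.
- by move=> *; rewrite add0r.
- by move=> *; rewrite mulrA.
- by move=> *; rewrite mul1r.
- by move=> *; rewrite mul0r.
- by move=> *; rewrite mulrDl.
- by move=> *; rewrite mulrDr.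
- by move=> *; rewrite mulrC.
Qed.

HB.instance Definition _ := GRing.PzRing.on Uq.
HB.instance Definition _ := GRing.Lmodule.on Uq.

Lemma Uq_oner_neq0 : (1 : Uq) != 0.
Proof. by apply/eqP => /pcls_eq/counit_cong /eqP; rewrite /= oner_eq0. Qed.

HB.instance Definition _ := GRing.PzSemiRing_isNonZero.Build Uq Uq_oner_neq0.
HB.instance Definition _ :=
  GRing.Lmodule_isLalgebra.Build k Uq (@pres_scaleAl _ _ Uq_rel).
HB.instance Definition _ :=
  GRing.Lalgebra_isAlgebra.Build k Uq (@pres_scaleAr _ _ Uq_rel).

Definition Uq_E i : Uq := pres_gen Uq_rel (gen_E i).
Definition Uq_F i : Uq := pres_gen Uq_rel (gen_F i).
Definition Uq_K lam : Uq := pres_gen Uq_rel (gen_K lam).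

Definition Uq_Ediv i (n : nat) : Uq := (q_fact (q_simple i) n)^-1 *: Uq_E i ^+ n.

(* The homogeneous component of degree [nu] of the subalgebra generated by    *)
(* the [E_i]: the span of the monomials of degree [nu].                       *)
Definition Uq_plus (nu : dual_space D) : set Uq :=
  [set u | exists s : seq (k * seq I),
     (forall p, p \in s -> \sum_(i <- p.2) simple_root D i = nu) /\
     u = \sum_(p <- s) p.1 *: \prod_(i <- p.2) Uq_E i].

End QuantumGroup.

Arguments Uq_plus {C I} D {k} qr nu.

Section RestrictScalars.
Variables (k : comPzRingType) (A : algType k) (V : lmodType A).

Definition restrict_scalars : Type := V.
HB.instance Definition _ := GRing.Zmodule.on restrict_scalars.

Definition restrict_scale (c : k) (v : restrict_scalars) : restrict_scalars :=
  c%:A *: (v : V).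

Lemma restrict_scaleA c d v :
  restrict_scale c (restrict_scale d v) = restrict_scale (c * d) v.
Proof. by rewrite /restrict_scale scalerA -scalerAl mul1r scalerA. Qed.

Lemma restrict_scale1 : left_id 1 restrict_scale.
Proof. by move=> v; rewrite /restrict_scale scale1r scale1r. Qed.

Lemma restrict_scaleDr : right_distributive restrict_scale +%R.
Proof. by move=> c u v; apply: scalerDr. Qed.

Lemma restrict_scaleDl v : {morph restrict_scale^~ v : c d / c + d}.
Proof. by move=> c d; rewrite /restrict_scale scalerDl scalerDl. Qed.

HB.instance Definition _ :=
  GRing.Zmodule_isLmodule.Build k restrict_scalars
    restrict_scaleA restrict_scale1 restrict_scaleDr restrict_scaleDl.

End RestrictScalars.

Section Modules.
Variables (C : numFieldType) (I : finType) (D : root_datum C I).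
Variables (k : fieldType) (qr : k) (V : lmodType (Uq D qr)).

Local Notation E := (@Uq_E C I D k qr).
Local Notation F := (@Uq_F C I D k qr).
Local Notation K := (@Uq_K C I D k qr).

Definition weight_space (beta : dual_space D) : set V :=
  [set m | forall lam : half_lattice D,
     K lam *: m = (q_pow D qr (root_form (half_val lam) beta))%:A *: m].

Record in_O_int : Prop := InOInt {
  O_int_span : forall m : V,
    exists (s : seq (dual_space D)) (f : dual_space D -> V),
      (forall beta, beta \in s ->
         weight_lattice D beta /\ weight_space beta (f beta)) /\
      m = \sum_(beta <- s) f beta;
  O_int_direct : forall (s : seq (dual_space D)) (f : dual_space D -> V),
    uniq s ->
    (forall beta, beta \in s ->
       weight_lattice D beta /\ weight_space beta (f beta)) ->
    \sum_(beta <- s) f beta = 0 -> forall beta, beta \in s -> f beta = 0;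
  O_int_E_nilp : forall i (m : V), exists n, E i ^+ n *: m = 0;
  O_int_F_nilp : forall i (m : V), exists n, F i ^+ n *: m = 0;
  O_int_bounded : forall m : V, exists N : nat, forall n : I -> nat,
    (N <= \sum_i n i)%N ->
    forall u, Uq_plus D qr (\sum_i simple_root D i *+ n i) u -> u *: m = 0
}.

Definition is_sigma (i : I) (g : restrict_scalars V -> restrict_scalars V) :=
  forall (l j : nat) (u : V), (j <= l)%N ->
    F i *: u = 0 ->
    (K (half_root D i) - (q_simple D qr i ^- l)%:A) *: u = 0 ->
    g (Uq_Ediv D qr i j *: u) = Uq_Ediv D qr i (l - j) *: u.

(* The operator [sigma^i_V]. Being an involution it lies in [GL]; the default *)
(* value [1] is relevant only for modules outside the category.               *)
Definition sigma (i : I) : GL (restrict_scalars V) :=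
  xget 1%g [set g : GL (restrict_scalars V) | is_sigma i g].

Definition sigma_group := generated sigma.

Definition J_set : {set I} := [set i | `[< forall v : V, F i *: v = 0 >]]%SET.

End Modules.

(* Main.v *)
Require Import Defs.
From HB Require Import structures.
From mathcomp Require Import all_boot all_order all_algebra.
From mathcomp Require Import ring zify.
From mathcomp Require Import all_classical reals.

Set Implicit Arguments.
Unset Strict Implicit.
Unset Printing Implicit Defensive.

Import Order.TTheory GRing.Theory Num.Theory.
Local Open Scope ring_scope.

(** A homomorphism out of [W(V)] exists as soon as every relation between the
operators [sigma^i] also holds between the prescribed images. The [sigma^i]
are involutions, so relations are equations [word = 1] in words over [I]. The
bridge between the two groups is the action on weights: [sigma^i] maps the
weight space [V(beta)] into [V(s_i beta)] ([sigma_weight]). So if a word in the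
[sigma^i] is trivial, the same word in the [s_i] fixes every weight of [V],
because distinct weight spaces are independent.

The letters in [J(V)] can be erased from that word. If [F_i] kills [V], the
relation between [E_i F_i - F_i E_i] and [K_i] forces every weight of [V] to
vanish on the coroot of [i], hence fixed by [s_i]. For a letter [i] outside
[J(V)] there are weights [beta] and [beta - alpha_i] of [V]. An element [w] of
the Weyl group that fixes both fixes [alpha_i] by linearity. The erased word
therefore gives a [w] that is a product of reflections [s_i], [i] outside
[J(V)], and that fixes [alpha_i] for all those [i].

Such a [w] is the identity on the whole dual space ([act_trivial]). The reason
is the standard one for Coxeter groups: when [w = u s_i] is a reduced
expression, [u alpha_i] is a nonnegative combination of simple roots
([reduced_positive]), so [w alpha_i] is a nonpositive one and differs from
[alpha_i]. Positivity is proved by reduction to two reflections, where the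
orbits of the two simple roots are computed explicitly.

The operators [sigma^i] must also be shown to exist, since the statement
speaks of them through a choice. This concerns one copy of quantum [sl_2]: an
integrable module is a sum of strings [E^(j) u], [0 <= j <= l], with [F u = 0]
and [u] of weight [-l] ([wt_strings]), the lowest vectors [u] are determined by
their sum ([strings_independent]), and [sigma^i] is the operator that turns each
string upside down. An operator [L] that commutes with [E], [F], [K] up to
scalars [r], [1/r], [1] permutes the strings. Comparing [j] with [l - j] gives
[L sigma = r^(-m) sigma L] on weight [m] ([string_flip_twist]). With [L] an
element [K_lambda] of the torus, this is the statement that [sigma^i] maps
[V(beta)] to [V(s_i beta)]. *)

(** * Reflection groups: positivity of reduced words *)

Section ReflectionWords.
Variables (C : numFieldType) (V : lmodType C) (T : eqType).
Variables (alpha : T -> V) (c : T -> V -> C) (a : T -> T -> int).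
Hypothesis c_linear : forall i, scalar (c i).
Hypothesis c_alpha : forall i j, c i (alpha j) = (a i j)%:~R.
Hypothesis a_diag : forall i, a i i = 2.
Hypothesis a_off : forall i j, i != j -> a i j <= 0.
Hypothesis a_zero : forall i j, a i j = 0 -> a j i = 0.

Definition refl (i : T) (x : V) : V := x - c i x *: alpha i.
Definition act (w : seq T) (x : V) : V := foldr refl x w.

Lemma corootZD i r x y : c i (r *: x + y) = r * c i x + c i y.
Proof. exact: c_linear. Qed.

Lemma refl_linear i : linear (refl i).
Proof.
move=> r x y; rewrite /refl corootZD scalerBr scalerDl scalerA opprD.
by rewrite addrACA.
Qed.

Lemma act_cons i w x : act (i :: w) x = refl i (act w x).
Proof. by []. Qed.

Lemma act_linear w : linear (act w).
Proof.
elim: w => [//|i w IH] r x y.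
by rewrite !act_cons IH refl_linear.
Qed.

HB.instance Definition _ w :=
  GRing.isLinear.Build C V V *:%R (act w) (act_linear w).

Lemma actD w : {morph act w : x y / x + y}.
Proof. exact: raddfD. Qed.

Lemma actN w : {morph act w : x / - x}.
Proof. exact: raddfN. Qed.

Lemma actMn w n : {morph act w : x / x *+ n}.
Proof. exact: raddfMn. Qed.

Lemma actMz w n : {morph act w : x / x *~ n}.
Proof. exact: raddfMz. Qed.

Lemma act_cat w w' x : act (w ++ w') x = act w (act w' x).
Proof. by rewrite /act foldr_cat. Qed.

Lemma act_rcons w i x : act (rcons w i) x = act w (refl i x).
Proof. by rewrite -cats1 act_cat. Qed.

Lemma refl_alpha i j : refl i (alpha j) = alpha j - alpha i *~ a i j.
Proof. by rewrite /refl c_alpha scaler_int. Qed.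

Lemma refl_alpha_diag i : refl i (alpha i) = - alpha i.
Proof. by rewrite refl_alpha a_diag -pmulrn mulr2n opprD addNKr. Qed.

Lemma reflK i : involutive (refl i).
Proof.
move=> x; rewrite {2}/refl -scaleNr addrC refl_linear refl_alpha_diag.
by rewrite /refl scalerN scaleNr opprK addrC subrK.
Qed.

Definition same (w w' : seq T) := forall x, act w x = act w' x.

Definition reduced (w : seq T) :=
  forall w', same w' w -> (size w <= size w')%N.

Lemma same_rcons2 w i : same (rcons (rcons w i) i) w.
Proof. by move=> x; rewrite !act_rcons reflK. Qed.

Lemma same_rcons w w' i : same w w' -> same (rcons w i) (rcons w' i).
Proof. by move=> e x; rewrite !act_rcons. Qed.

Lemma same_sym w w' : same w w' -> same w' w.
Proof. by move=> e x. Qed.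

Lemma same_trans w w' w'' : same w w' -> same w' w'' -> same w w''.
Proof. by move=> e e' x; rewrite e. Qed.

Lemma same_cat u v u' v' : same u u' -> same v v' -> same (u ++ v) (u' ++ v').
Proof. by move=> e e' x; rewrite !act_cat e' e. Qed.

Lemma reduced_rcons w i : reduced (rcons w i) -> reduced w.
Proof.
move=> red w' e; have := red (rcons w' i) (same_rcons i e).
by rewrite !size_rcons ltnS.
Qed.

(** * Two reflections *)

(** The word in [i] and [j] alternately that ends in [j]: this is the normal
form of a reduced word in two letters that [i] does not shorten. *)
Fixpoint alt (n : nat) (i j : T) : seq T :=
  if n is n'.+1 then rcons (alt n' j i) j else [::].

Lemma altS n i j : alt n.+1 i j = rcons (alt n j i) j.
Proof. by []. Qed.

Lemma size_alt n i j : size (alt n i j) = n.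
Proof. by elim: n i j => //= n IH i j; rewrite size_rcons IH. Qed.

Lemma alt_cat m n i j :
  exists u, size u = m /\ alt (m + n) i j = u ++ alt n i j.
Proof.
elim: n i j => [|n IH] i j.
  by exists (alt m i j); rewrite addn0 cats0 size_alt.
have [u [su e]] := IH j i.
by exists u; rewrite addnS /= e rcons_cat.
Qed.

(** A reduced word has no two equal neighbours, and it does not end in [i]
because appending [i] would then shorten it. *)
Lemma reduced_alt u i j : i != j -> {subset u <= [:: i; j]} -> reduced u ->
  (forall w, same w (rcons u i) -> (size u <= size w)%N) ->
  u = alt (size u) i j.
Proof.
elim/last_ind: u i j => [//|u x IH] i j ij sub red redi.
rewrite size_rcons /=.
have xi : x != i.
  apply/eqP => xi; have := redi u; rewrite xi size_rcons ltnn.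
  by move=> /(_ (same_sym (same_rcons2 u i))).
have xj : x = j.
  have : x \in [:: i; j] by apply: sub; rewrite mem_rcons mem_head.
  by rewrite !inE (negPf xi) => /eqP.
rewrite xj in sub red redi *; congr rcons.
apply: IH; first by rewrite eq_sym.
- move=> y yu; have : y \in [:: i; j].
    by apply: sub; rewrite mem_rcons inE yu orbT.
  by rewrite !inE orbC.
- exact: reduced_rcons red.
- by move=> w /red; rewrite size_rcons => /ltnW.
Qed.

Lemma act_alt_rec n i j :
  act (alt n.+2 i j) (alpha i) =
  act (alt n.+1 j i) (alpha j) *~ (- a j i) - act (alt n i j) (alpha i).
Proof.
rewrite (altS n.+1) act_rcons refl_alpha actD actN actMz mulrNz addrC.
by congr (_ + _); rewrite altS act_rcons refl_alpha_diag actN.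
Qed.

(** The coordinates on [alpha i], [alpha j] of the image of [alpha i] under
[alt n i j], with [b = - a j i] and [b' = - a i j]. *)
Fixpoint alt_coord (b b' : int) (n : nat) : int * int :=
  match n with
  | 0 => (1, 0)
  | n1.+1 =>
    match n1 with
    | 0 => (1, b)
    | n2.+1 => (b * (alt_coord b' b n1).2 - (alt_coord b b' n2).1,
                b * (alt_coord b' b n1).1 - (alt_coord b b' n2).2)
    end
  end.

Lemma alt_coordSS b b' n :
  alt_coord b b' n.+2 =
    (b * (alt_coord b' b n.+1).2 - (alt_coord b b' n).1,
     b * (alt_coord b' b n.+1).1 - (alt_coord b b' n).2).
Proof. by []. Qed.

Lemma act_alt n i j :
  let p := alt_coord (- a j i) (- a i j) n in
  act (alt n i j) (alpha i) = alpha i *~ p.1 + alpha j *~ p.2.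
Proof.
elim/ltn_ind: n i j => [[|[|n]]] IH i j.
- by rewrite /= mulr0z addr0.
- by rewrite /= refl_alpha mulrNz.
rewrite act_alt_rec !IH// alt_coordSS.
move: (alt_coord _ _ n.+1) (alt_coord _ _ n) => [p1 p2] [r1 r2] /=.
rewrite [alpha j *~ _ + _]addrC mulrzDl !mulrzBr opprD addrACA.
by rewrite ![- a j i * _]mulrC !mulrzA.
Qed.

(** When [b b' >= 4] the two reflections generate an infinite group and the
roots grow. Write [A_n] for the coordinates and [B_n] for those obtained by
exchanging the letters. Then [b B_(n+1) >= 2 A_n] entrywise, and this bound
reproduces itself: [b b' A_(n+1)] is at least [2 b B_n] and at least
[4 A_(n+1)], so the average of the two bounds gives
[b B_(n+2) = b b' A_(n+1) - b B_n >= 2 A_(n+1)]. *)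
Lemma alt_coord_ge0 b b' n : 0 <= b -> 0 <= b' -> 4 <= b * b' ->
  (0 <= (alt_coord b b' n).1) && (0 <= (alt_coord b b' n).2).
Proof.
move=> b0 b'0 bb'.
suff [] : let p := alt_coord b b' n in let q := alt_coord b b' n.+1 in
  let r := alt_coord b' b n.+1 in
  [/\ 0 <= p.1, 0 <= p.2, 0 <= q.1, 0 <= q.2 &
      (2 * p.1 <= b * r.2) /\ (2 * p.2 <= b * r.1)] by move=> /= -> ->.
elim: n b b' b0 b'0 bb' => [|n IH] b b' b0 b'0 bb'.
  by rewrite /=; split=> //; split; lia.
rewrite !alt_coordSS.
have [p1 p2 q1 q2 [pr1 pr2]] := IH b b' b0 b'0 bb'.
have [p1' p2' q1' q2' [pr1' pr2']] := IH b' b b'0 b0 ltac:(lia).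
cbv zeta in *; move: (alt_coord b b' n.+1) (alt_coord b' b n.+1) => q q'
  in p1 p2 q1 q2 pr1 pr2 p1' p2' q1' q2' pr1' pr2' *.
move: (alt_coord b b' n) (alt_coord b' b n) => p p'
  in p1 p2 q1 q2 pr1 pr2 p1' p2' q1' q2' pr1' pr2' *.
split=> //=; try lia.
split; nia.
Qed.

(** Any [x] can serve here: a word in the two reflections changes [x] only by
a combination of the two roots, which turns the braid relations into
polynomial identities in the pairings of [x]. *)
Lemma refl_comb i j x P Q :
  refl i (x - P *: alpha i - Q *: alpha j) =
  x - (c i x - P - (a i j)%:~R * Q) *: alpha i - Q *: alpha j.
Proof.
rewrite /refl -!scaleNr.
have -> : c i (x + - P *: alpha i + - Q *: alpha j) =
    c i x - 2 * P - (a i j)%:~R * Q.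
  by rewrite -addrA addrC -addrA !corootZD !c_alpha a_diag; ring.
rewrite addrAC; congr (_ + _); rewrite -addrA; congr (_ + _).
by rewrite -scalerDl; congr (_ *: _); ring.
Qed.

(** In the finite case [(a i j, a j i)] is one of [(0,0)], [(-1,-1)],
[(-1,-2)], [(-1,-3)] up to exchange, with dihedral groups of order [2n] for
[n = 2, 3, 4, 6]. Below the length [n] of the longest element no root has
become negative yet. *)
Lemma braid_rel i j : i != j -> a i j * a j i <= 3 ->
  exists n, [/\ (0 < n)%N, same (alt n i j) (alt n j i) &
    forall m, (m < n)%N -> let p := alt_coord (- a j i) (- a i j) m in
      (0 <= p.1) && (0 <= p.2)].
Proof.
move=> ij a3; have ji : j != i by rewrite eq_sym.
have aij := a_off ij; have aji := a_off ji.
have braid n : (forall x, let y P Q := x - P *: alpha i - Q *: alpha j in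
     (forall P Q, refl i (y P Q) = y (c i x - P - (a i j)%:~R * Q) Q) ->
     (forall P Q, refl j (y P Q) = y P (c j x - Q - (a j i)%:~R * P)) ->
     act (alt n i j) (y 0 0) = act (alt n j i) (y 0 0)) ->
  same (alt n i j) (alt n j i).
  move=> H x; have /= := H x; rewrite !scale0r !subr0; apply=> P Q.
    exact: refl_comb.
  by rewrite addrAC refl_comb addrAC.
have : [\/ a i j = 0 /\ a j i = 0, a i j = -1 /\ a j i = -1,
  (a i j = -1 /\ a j i = -2) \/ (a i j = -2 /\ a j i = -1) |
  (a i j = -1 /\ a j i = -3) \/ (a i j = -3 /\ a j i = -1)].
  have [z|nz] := eqVneq (a i j) 0; first by apply: Or41; rewrite (a_zero z).
  have nz' : a j i != 0 by apply: contra_neq nz => /a_zero.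
  have [e|e] : a i j = -1 \/ a i j <= -2 by lia.
    have : a j i = -1 \/ a j i = -2 \/ a j i = -3 by lia.
    by case=> [|[]] ->; rewrite e; [apply: Or42|apply: Or43; left|apply: Or44; left].
  have e' : a j i = -1 by nia.
  have : a i j = -2 \/ a i j = -3 by lia.
  by case=> ->; rewrite e'; [apply: Or43; right|apply: Or44; right].
case=> [[e e']|[e e']|[] [e e']|[] [e e']]; rewrite e e';
  [exists 2|exists 3|exists 4|exists 4|exists 6|exists 6]; split=> //;
  try (by do 7?[case=> //]);
  apply: braid => x y yi yj; rewrite /act /= !(yi, yj) e e';
  by congr (y _ _); ring.
Qed.

(** A word long enough to contain the braid relation at its end would be
shortened by [i], so in the finite case only lengths below that of the longest
element occur. *)
Lemma reduced_rank2 u i j : i != j -> {subset u <= [:: i; j]} -> reduced u ->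
  (forall w, same w (rcons u i) -> (size u <= size w)%N) ->
  exists p q : nat, act u (alpha i) = alpha i *+ p + alpha j *+ q.
Proof.
move=> ij sub red redi.
have ji : j != i by rewrite eq_sym.
have ue := reduced_alt ij sub red redi.
suff /andP[] : (0 <= (alt_coord (- a j i) (- a i j) (size u)).1) &&
           (0 <= (alt_coord (- a j i) (- a i j) (size u)).2).
  rewrite ue act_alt size_alt.
  case: (alt_coord _ _ _) => -[p|//] [q|//] _ _.
  by exists p, q.
have aij := a_off ij; have aji := a_off ji.
have [/(braid_rel ij)[n [n0 br pos]]|ab] := leP (a i j * a j i) 3; last first.
  by apply: alt_coord_ge0; lia.
have [/pos//|nu] := ltnP (size u) n.
have [v [sv e]] := alt_cat (size u - n) n i j; rewrite subnK// in e.
case: n => [//|n] in n0 br pos nu v sv e *.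
have := redi (v ++ alt n i j); rewrite size_cat size_alt sv.
suff h : same (v ++ alt n i j) (rcons u i) by move/(_ h); lia.
rewrite ue e -cats1 -catA; apply: same_cat => //.
apply: same_trans (same_sym (same_rcons2 (alt n i j) i)) _.
rewrite cats1; apply: same_rcons; exact: same_sym.
Qed.

(** * Reduced words send simple roots to the positive cone *)

Definition in_cone (x : V) := exists s : seq T, x = \sum_(i <- s) alpha i.

Lemma in_coneD x y : in_cone x -> in_cone y -> in_cone (x + y).
Proof. by move=> [s ->] [t ->]; exists (s ++ t); rewrite big_cat. Qed.

Lemma in_coneMn x n : in_cone x -> in_cone (x *+ n).
Proof.
move=> cx; elim: n => [|n IH]; first by exists [::]; rewrite big_nil.
by rewrite mulrS; apply: in_coneD.
Qed.

(** Factor [w] as [v u] without loss of length, with [u] a word in [i] and in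
the last letter [j] of [w], and [v] as short as possible. Then neither [i] nor
[j] shortens [v], so [v alpha_i] and [v alpha_j] are positive by induction on
the length; and [u alpha_i] is a nonnegative combination of [alpha_i] and
[alpha_j] by the computation for two reflections. *)
Lemma reduced_positive w i : reduced w ->
  (forall w', same w' (rcons w i) -> (size w <= size w')%N) ->
  in_cone (act w (alpha i)).
Proof.
elim/ltn_ind: {w}(size w) {-2}w (erefl (size w)) i => n IHn w wn i red redi.
have [w0|[w1 [j wj]]] : w = [::] \/ exists w1 j, w = rcons w1 j.
- by case/lastP: w {wn red redi} => [|w1 j]; [left|right; exists w1, j].
- by rewrite w0; exists [:: i]; rewrite big_seq1.
have ij : i != j.
  apply/eqP => ij; have := redi w1; rewrite wj ij size_rcons ltnn.
  by move=> /(_ (same_sym (same_rcons2 w1 j))).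
have : exists v u, [/\ same w (v ++ u), (size v + size u = n)%N, (0 < size u)%N &
    {subset u <= [:: i; j]}].
  exists w1, [:: j]; rewrite -wn wj size_rcons addn1 cats1; split=> //.
  by move=> x; rewrite !inE => ->; rewrite orbT.
(* While [i] or [j] shortens [v], move that letter from [v] to [u]. *)
case=> v; elim/ltn_ind: {v}(size v) {-2}v (erefl (size v)) => m IHm v vm.
move=> [u [e sz u0 sub]].
have redv : reduced v.
  move=> v' ev; have := red (v' ++ u); rewrite size_cat wn -sz leq_add2r; apply.
  apply: same_trans (same_sym e); exact: same_cat.
have redu : reduced u.
  move=> u' eu; have := red (v ++ u'); rewrite size_cat wn -sz leq_add2l; apply.
  apply: same_trans (same_sym e); exact: same_cat.
have redui : forall u', same u' (rcons u i) -> (size u <= size u')%N.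
  move=> u' eu; have := redi (v ++ u'); rewrite size_cat wn -sz leq_add2l; apply.
  apply: same_trans (same_rcons i (same_sym e)); rewrite -cats1 -catA cats1.
  exact: same_cat.
have [[h [hij [v' [ev lt]]]]|min] := pselect (exists h, h \in [:: i; j] /\
    exists v', same v' (rcons v h) /\ (size v' < size v)%N).
  have ev' : same v (rcons v' h).
    by apply: same_trans (same_sym (same_rcons2 v h)) _; apply/same_rcons/same_sym.
  have sv' : (size v).-1 = size v'.
    by have := redv _ (same_sym ev'); rewrite size_rcons; lia.
  apply: (IHm (size v') _ v' erefl); first by rewrite -vm.
  exists (h :: u); split=> //=.
  - apply: same_trans e _; rewrite -cat_rcons; exact: same_cat.
  - by move: lt; rewrite -sz; lia.
  - by move=> x; rewrite inE => /orP[/eqP->//|/sub].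
have pos h : h \in [:: i; j] -> in_cone (act v (alpha h)).
  move=> hij; apply: (IHn (size v) _ v erefl) => //.
    by rewrite -sz; lia.
  move=> v' ev; rewrite leqNgt; apply/negP => lt; apply: min.
  by exists h; split=> //; exists v'.
have [p [q eu]] := reduced_rank2 ij sub redu redui.
rewrite e act_cat eu actD !actMn.
by apply: in_coneD; apply: in_coneMn; apply: pos; rewrite !inE eqxx ?orbT.
Qed.

Lemma exists_reduced w : exists w', same w' w /\ reduced w'.
Proof.
elim/ltn_ind: {w}(size w) {-2}w (erefl (size w)) => n IH w wn.
have [red|] := pselect (reduced w); first by exists w.
move=> /existsNP[w1 /not_implyP[e /negP]]; rewrite -ltnNge wn => lt.
have [w2 [e2 red2]] := IH _ lt w1 erefl.
by exists w2; split=> //; apply: same_trans e.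
Qed.

(** If a reduced expression of [w] ended in [i], then [w alpha_i] would be the
opposite of a positive element. *)
Theorem act_trivial w :
  (forall i, ~ in_cone (- alpha i)) ->
  (forall i, act w (alpha i) = alpha i) -> forall x, act w x = x.
Proof.
move=> pointed; have [w' [e red]] := exists_reduced w => fix_alpha x.
rewrite -e; case/lastP: w' => [//|u i] in e red *.
case: (pointed i); rewrite -{1}fix_alpha -e act_rcons refl_alpha_diag actN opprK.
apply: reduced_positive; first exact: reduced_rcons red.
by move=> w' /red; rewrite size_rcons => /ltnW.
Qed.

End ReflectionWords.

(** * Quantum sl_2: strings in an integrable module *)

Section QuantumSl2.
Variables (k : fieldType) (V : lmodType k) (q : k) (E F K : {linear V -> V}).
Hypothesis q_neq0 : q != 0.
Hypothesis q_inf : forall n, (0 < n)%N -> q ^+ n != 1.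

(** The quantum integer [(m)_q], extended to negative [m]. *)
Definition qint (m : int) : k := (q ^ m - q ^ (- m)) / (q - q^-1).
Definition wt (m : int) (v : V) := K v = q ^ m *: v.

Hypothesis EF_wt : forall m v, wt m v -> E (F v) - F (E v) = qint m *: v.
Hypothesis KE : forall v, K (E v) = q ^ 2 *: E (K v).
Hypothesis KF : forall v, K (F v) = q ^ (-2) *: F (K v).
Hypothesis E_nilp : forall v, exists n, iter n E v = 0.
Hypothesis F_nilp : forall v, exists n, iter n F v = 0.
Hypothesis wt_span : forall P : V -> Prop, P 0 ->
  (forall x y, P x -> P y -> P (x + y)) ->
  (forall m v, wt m v -> P v) -> forall v, P v.

Definition Ediv (n : nat) (v : V) : V := (q_fact q n)^-1 *: iter n E v.

(** Lowest vectors of weight [-l]; they generate the strings. *)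
Definition prim (l : nat) (u : V) := F u = 0 /\ K u = q ^- l *: u.

Lemma qexp_eq1 (m : int) : q ^ m = 1 -> m = 0.
Proof.
case: m => n; first by case: n => // n /eqP e; case/negP: (q_inf (ltn0Sn n)).
by move=> /eqP; rewrite /exprz invr_eq1 => /(negP (q_inf (ltn0Sn n))).
Qed.

Lemma qexp_inj : injective (fun m : int => q ^ m).
Proof.
move=> m n /= e; apply/eqP; rewrite -subr_eq0; apply/eqP/qexp_eq1.
by rewrite expfzDr// e -expfzDr// subrr.
Qed.

Lemma q_sub_inv_neq0 : q - q^-1 != 0.
Proof.
by rewrite subr_eq0; apply/eqP => /(@qexp_inj 1 (-1)).
Qed.

Lemma qint_neq0 m : m != 0 -> qint m != 0.
Proof.
move=> m0; rewrite /qint mulf_neq0 ?invr_eq0 ?q_sub_inv_neq0//.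
by rewrite subr_eq0; apply/eqP => /qexp_inj; lia.
Qed.

Lemma qint1 : qint 1 = 1.
Proof. by rewrite /qint divff// q_sub_inv_neq0. Qed.

Lemma qintN m : qint (- m) = - qint m.
Proof. by rewrite /qint opprK -mulNr opprB. Qed.

(** The induction step of [F_iterE]: commuting [F] past one more [E]. *)
Lemma qint_mul x y :
  qint x * qint y - qint (x + 1 - y) = qint (x + 1) * qint (y - 1).
Proof.
rewrite /qint; have := q_sub_inv_neq0.
have -> : - (x + 1 - y) = y + (-1) + (- x) by ring.
rewrite !opprD opprK !expfzDr// -!invr_expz expr1z.
have x0 : q ^ x != 0 by rewrite expfz_neq0.
have y0 : q ^ y != 0 by rewrite expfz_neq0.
move=> qq; field; rewrite x0 y0 q_neq0 /= andbT.
by have := q_inf (isT : (0 < 2)%N); rewrite expr2 subr_eq0.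
Qed.

Lemma q_number_int n : q_number q n = qint n%:Z.
Proof. by rewrite /q_number /qint -exprnN. Qed.

Lemma q_factS n : q_fact q n.+1 = q_fact q n * qint n.+1.
Proof. by rewrite /q_fact big_nat_recr//= q_number_int. Qed.

Lemma q_fact_neq0 n : q_fact q n != 0.
Proof.
elim: n => [|n IH]; first by rewrite /q_fact big_geq ?oner_eq0.
by rewrite q_factS mulf_neq0// qint_neq0.
Qed.

Lemma wtE m v : wt m v -> wt (m + 2) (E v).
Proof. by rewrite /wt KE => ->; rewrite linearZ /= scalerA -expfzDr// addrC. Qed.

Lemma wtF m v : wt m v -> wt (m - 2) (F v).
Proof. by rewrite /wt KF => ->; rewrite linearZ /= scalerA -expfzDr// addrC. Qed.

Lemma wtB m v w : wt m v -> wt m w -> wt m (v - w).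
Proof. by rewrite /wt raddfB /= => -> ->; rewrite scalerBr. Qed.

Lemma wt_iterE m v n : wt m v -> wt (m + 2 * n%:Z) (iter n E v).
Proof.
move=> wv; elim: n => [|n IH]; first by rewrite mulr0 addr0.
by have := wtE IH; congr wt; lia.
Qed.

(** The hypothesis [E (F v) = 0] covers lowest vectors, and also the vectors
that have to be excluded in [EF_eq0]. *)
Lemma F_iterE m v n : wt m v -> E (F v) = 0 ->
  F (iter n.+1 E v) = (qint n.+1 * qint (- m - n%:Z)) *: iter n E v.
Proof.
move=> wv EFv; elim: n => [|n IH].
  have := EF_wt wv; rewrite EFv sub0r /= => /eqP.
  rewrite eqr_oppLR => /eqP ->; rewrite -scaleNr subr0; congr (_ *: _).
  by rewrite qint1 mul1r -qintN; congr qint; lia.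
have := EF_wt (wt_iterE n.+1 wv); rewrite IH linearZ /= => e.
have {e} -> : F (E (E (iter n E v))) =
    (qint n.+1 * qint (- m - n%:Z)) *: E (iter n E v) -
    qint (m + 2 * n.+1%:Z) *: E (iter n E v).
  by rewrite -e opprB addrC subrK.
rewrite -scalerBl; congr (_ *: _).
have := qint_mul n.+1 (- m - n%:Z).
have -> : n.+1%:Z + 1 - (- m - n%:Z) = m + 2 * n.+1%:Z by lia.
by move=> ->; congr (qint _ * qint _); lia.
Qed.

Lemma prim_wt l u : prim l u -> wt (- l%:Z) u.
Proof. by case=> _; rewrite /wt -exprnN. Qed.

Lemma primZD l r u v : prim l u -> prim l v -> prim l (r *: u + v).
Proof.
move=> [fu ku] [fv kv]; split; rewrite linearP ?fu ?fv ?ku ?kv /=.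
  by rewrite scaler0 addr0.
by rewrite [RHS]scalerDr !scalerA mulrC.
Qed.

Lemma prim0 l : prim l 0.
Proof. by split; rewrite raddf0 ?scaler0. Qed.

Lemma Ediv_is_linear n : linear (Ediv n).
Proof.
move=> r u v; rewrite /Ediv.
have -> : iter n E (r *: u + v) = r *: iter n E u + iter n E v.
  by elim: n => //= n ->; rewrite linearP.
by rewrite scalerDr !scalerA mulrC.
Qed.

HB.instance Definition _ n :=
  GRing.isLinear.Build k V V *:%R (Ediv n) (Ediv_is_linear n).

Lemma EdivZ n c u : Ediv n (c *: u) = c *: Ediv n u.
Proof. exact: linearZ. Qed.

Lemma E_Ediv n u : E (Ediv n u) = qint n.+1 *: Ediv n.+1 u.
Proof.
rewrite /Ediv linearZ scalerA q_factS; congr (_ *: _).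
by rewrite invfM mulrC divfK// qint_neq0.
Qed.

Lemma F_Ediv l n u : prim l u ->
  F (Ediv n.+1 u) = qint (l%:Z - n%:Z) *: Ediv n u.
Proof.
move=> pu; have [Fu _] := pu.
rewrite /Ediv linearZ (F_iterE n (prim_wt pu)) ?Fu ?raddf0// /= !scalerA opprK.
congr (_ *: _); rewrite q_factS; field.
by rewrite qint_neq0// q_fact_neq0.
Qed.

(** Strings have length exactly [l]: since [F] acts on [E^(n+1) u] by the nonzero
factor [(l - n)_q] for [n > l], the local nilpotency of [E] propagates down to
[n = l + 1]. *)
Lemma Ediv_top l n u : prim l u -> (l < n)%N -> Ediv n u = 0.
Proof.
move=> pu ln; have [N EN] := E_nilp u.
have : Ediv (N + n) u = 0.
  rewrite /Ediv addnC iterD EN; elim: (X in iter X) => [|j IH] /=.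
    by rewrite scaler0.
  by have := congr1 E IH; rewrite linearZ raddf0.
elim: N {EN} => [//|N IH] e; apply: IH.
have := congr1 F e; rewrite addSn (F_Ediv _ pu) raddf0 => /eqP.
by rewrite scaler_eq0 (negPf (qint_neq0 _)) => [/eqP//|]; lia.
Qed.

(** In positive weight [m] the factors [(n+1)_q (-m-n)_q] by which [F] undoes
[E^(n+1)] never vanish, so local nilpotency of [E] kills [v]. *)
Lemma EF_eq0 m v : wt m v -> 0 < m -> E (F v) = 0 -> v = 0.
Proof.
move=> wv m0 EFv; have [n] := E_nilp v.
elim: n => [//|n IH] e; apply: IH.
have := congr1 F e; rewrite (F_iterE n wv EFv) raddf0 => /eqP.
by rewrite scaler_eq0 mulf_eq0 !(negPf (qint_neq0 _)) => [/eqP//||]; lia.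
Qed.

Lemma iterF_Ediv l n u : prim l u ->
  iter n F (Ediv n u) = (\prod_(i < n) qint (l%:Z - i%:Z)) *: u.
Proof.
move=> pu; elim: n => [|n IH].
  by rewrite /Ediv /q_fact big_geq// invr1 big_ord0 !scale1r.
rewrite iterSr (F_Ediv n pu).
have -> : forall c v, iter n F (c *: v) = c *: iter n F v.
  by move=> c v; elim: n {IH} => //= n ->; rewrite linearZ.
by rewrite IH scalerA big_ord_recr /= mulrC.
Qed.

Lemma iterF0 n : iter n F 0 = 0.
Proof. by elim: n => //= n ->; rewrite raddf0. Qed.

Lemma iterFD n x y : iter n F (x + y) = iter n F x + iter n F y.
Proof. by elim: n => //= n ->; rewrite raddfD. Qed.

Lemma iterF_Ediv0 l m n u : prim l u -> (m < n)%N -> iter n F (Ediv m u) = 0.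
Proof.
move=> pu mn; rewrite -(subnK mn) addnS -addSn iterD (iterF_Ediv m pu).
rewrite iterSr linearZ; have [-> _] := pu.
by rewrite /= scaler0 iterF0.
Qed.

Inductive strings (m : int) : V -> Prop :=
| strings0 : strings m 0
| stringsD x y : strings m x -> strings m y -> strings m (x + y)
| strings_gen l j u : prim l u -> (j <= l)%N -> m = 2 * j%:Z - l%:Z ->
    strings m (Ediv j u).

Lemma strings_wt m v : strings m v -> wt m v.
Proof.
elim=> [|x y _ wx _ wy|l j u pu _ ->]; rewrite /wt.
- by rewrite raddf0 scaler0.
- by move: wx wy; rewrite /wt raddfD /= => -> ->; rewrite scalerDr.
- rewrite /Ediv linearZ (wt_iterE j (prim_wt pu)) /= !scalerA mulrC.
  by congr (_ ^ _ * _ *: _); lia.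
Qed.

(** All but the top of each string lies in the image of [F], and the tops are
killed by [E]. A top of weight [m] has [m >= 0]. *)
Lemma strings_lift m y : strings m y -> exists v,
  [/\ strings (m + 2) v, E (y - F v) = 0 & m + 2 <= 0 -> y = F v].
Proof.
elim=> [|x y' _ [v [sv Ev v0]] _ [w [sw Ew w0]]|l j u pu jl mE].
- by exists 0; split; [exact: strings0|rewrite !(raddf0, subr0)|rewrite raddf0].
- exists (v + w); split; first exact: stringsD.
  + by rewrite (raddfD F) /= opprD addrACA (raddfD E) /= Ev Ew addr0.
  + by move=> m0; rewrite (raddfD F) /= -v0// -w0.
- have [jltl|] := ltnP j l.
    have c0 : qint (l%:Z - j%:Z) != 0 by apply: qint_neq0; lia.
    pose w := (qint (l%:Z - j%:Z))^-1 *: u.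
    have pw : prim l w.
      by have := primZD (qint (l%:Z - j%:Z))^-1 pu (prim0 l); rewrite addr0.
    have Fw : F (Ediv j.+1 w) = Ediv j u.
      by rewrite (F_Ediv j pw) EdivZ scalerA divff ?scale1r.
    exists (Ediv j.+1 w); split; rewrite ?Fw ?subrr ?raddf0//.
    by apply: strings_gen pw jltl _; lia.
  move=> lj; have {jl lj} jl : j = l by apply/eqP; rewrite eqn_leq jl.
  rewrite jl in mE *.
  exists 0; split; [exact: strings0| |by move=> m0; exfalso; lia].
  by rewrite raddf0 subr0 E_Ediv (Ediv_top pu) ?scaler0.
Qed.

(** Induction on the order of nilpotency of [F] on [v]. Subtracting a lift of
the strings in [F v] leaves a vector [w] with [E F w = 0]. It vanishes in
positive weight, and in weight at most [0] it is a lowest vector. *)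
Lemma wt_strings m v : wt m v -> strings m v.
Proof.
have [n] := F_nilp v; elim: n m v => [|n IH] m v.
  by move=> /= -> _; apply: strings0.
rewrite iterSr => Fv wv.
have [v0] := strings_lift (IH _ _ Fv (wtF wv)).
rewrite subrK => -[sv0 Ev0 low]; rewrite -(subrK v0 v).
apply: stringsD => //; have ww := wtB wv (strings_wt sv0).
have [m0|m0] := ltP 0 m.
  rewrite (EF_eq0 ww m0); first exact: strings0.
  by rewrite [F _]raddfB.
have Fw : F (v - v0) = 0 by rewrite raddfB /= -low// subrr.
have -> : v - v0 = Ediv 0 (v - v0) by rewrite /Ediv /q_fact big_geq// invr1 scale1r.
have [l ml] : exists l : nat, m = - l%:Z by exists `|m|%N; lia.
by apply: (@strings_gen _ l); [split=> //; rewrite ww ml -exprnN| |rewrite ml; lia].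
Qed.

(** Finite families of lowest vectors are indexed by the length [l] and the
position [j] in the string, with [j <= l < N]; vanishing outside of this range
makes families with different [N] comparable. *)
Definition dsum (N : nat) (f : nat -> nat -> V) : V :=
  \sum_(j < N) \sum_(l < N) f l j.

Definition vanishes_off (N : nat) (f : nat -> nat -> V) :=
  forall l j, ~~ (j <= l < N)%N -> f l j = 0.

Lemma dsum_widen N M f : vanishes_off N f -> (N <= M)%N -> dsum M f = dsum N f.
Proof.
move=> f0 /subnK <-; elim: (M - N)%N => // n <-.
rewrite addSn /dsum big_ord_recr /= [X in _ + X]big1 ?addr0 => [|l _]; last first.
  by apply: f0; lia.
apply: eq_bigr => j _; rewrite big_ord_recr /= [X in _ + X]f0 ?addr0//.
by lia.
Qed.

Lemma dsumP N r (f g : nat -> nat -> V) :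
  dsum N (fun l j => r *: f l j + g l j) = r *: dsum N f + dsum N g.
Proof.
rewrite /dsum scaler_sumr -big_split /=; apply: eq_bigr => j _.
by rewrite scaler_sumr -big_split.
Qed.

(** The operator that turns strings upside down; it is only a relation until the
strings are known to be independent. *)
Definition sigma_graph (x y : V) := exists N u,
  [/\ forall l j, prim l (u l j), vanishes_off N u,
      x = dsum N (fun l j => Ediv j (u l j)) &
      y = dsum N (fun l j => Ediv (l - j) (u l j))].

Lemma Ediv_vanishes N (u : nat -> nat -> V) (h : nat -> nat -> nat) :
  vanishes_off N u -> vanishes_off N (fun l j => Ediv (h l j) (u l j)).
Proof. by move=> u0 l j lj; rewrite u0// raddf0. Qed.

Lemma sigma_graphP r x y x' y' : sigma_graph x y -> sigma_graph x' y' ->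
  sigma_graph (r *: x + x') (r *: y + y').
Proof.
move=> [N [u [pu u0 -> ->]]] [N' [u' [pu' u0' -> ->]]].
have leN : (N <= maxn N N')%N by rewrite leq_maxl.
have leN' : (N' <= maxn N N')%N by rewrite leq_maxr.
exists (maxn N N'), (fun l j => r *: u l j + u' l j); split.
- by move=> l j; apply: primZD.
- move=> l j lj; rewrite u0 ?u0' ?scaler0 ?addr0//; lia.
- rewrite -(dsum_widen (Ediv_vanishes (fun l j => j) u0) leN).
  rewrite -(dsum_widen (Ediv_vanishes (fun l j => j) u0') leN') -dsumP.
  by apply: eq_bigr => j _; apply: eq_bigr => l _; rewrite linearP.
- rewrite -(dsum_widen (Ediv_vanishes (fun l j => (l - j)%N) u0) leN).
  rewrite -(dsum_widen (Ediv_vanishes (fun l j => (l - j)%N) u0') leN') -dsumP.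
  by apply: eq_bigr => j _; apply: eq_bigr => l _; rewrite linearP.
Qed.

Lemma sigma_graph_Ediv l j u : prim l u -> (j <= l)%N ->
  sigma_graph (Ediv j u) (Ediv (l - j) u).
Proof.
move=> pu jl.
pose w l' j' := if (l' == l) && (j' == j) then u else 0.
have dsum1 (h : nat -> nat -> nat) :
    dsum l.+1 (fun l j => Ediv (h l j) (w l j)) = Ediv (h l j) u.
  rewrite /dsum (bigD1 (Ordinal (jl : (j < l.+1)%N)))//= (bigD1 ord_max)//=.
  rewrite /w !eqxx [X in _ + X + _]big1 => [|i]; last first.
    by rewrite -val_eqE /= => /negPf ->; rewrite raddf0.
  rewrite addr0 big1 ?addr0// => i; rewrite -val_eqE /= => /negPf ij.
  by rewrite big1// => i' _; rewrite ij andbF raddf0.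
exists l.+1, w; split.
- move=> l' j'; rewrite /w; case: ifP => [/andP[/eqP-> _]//|_]; exact: prim0.
- by move=> l' j'; rewrite /w; case: ifP => // /andP[/eqP-> /eqP->]; lia.
- by rewrite (dsum1 (fun _ j => j)).
- by rewrite (dsum1 (fun l j => (l - j)%N)).
Qed.

Lemma sigma_graph0 : sigma_graph 0 0.
Proof.
by have := sigma_graph_Ediv (prim0 0) (leqnn 0); rewrite raddf0.
Qed.

Lemma sigma_graph_total x : exists y, sigma_graph x y.
Proof.
apply: (wt_span (P := fun x => exists y, sigma_graph x y)).
- by exists 0; apply: sigma_graph0.
- move=> u v [u' gu] [v' gv]; exists (1 *: u' + v').
  by rewrite -[u]scale1r; apply: sigma_graphP.
move=> m v /wt_strings; elim=> [|u w _ [u' gu] _ [v' gv]|l j u pu jl _].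
- by exists 0; apply: sigma_graph0.
- exists (1 *: u' + v').
  by rewrite -[u]scale1r; apply: sigma_graphP.
- by exists (Ediv (l - j) u); apply: sigma_graph_Ediv.
Qed.

(** Eigenvectors of [K] with distinct eigenvalues [q^(-l)]: applying
[K - q^(-N)] removes the last one. *)
Lemma K_independent N (x : nat -> V) : (forall l, K (x l) = q ^- l *: x l) ->
  \sum_(l < N) x l = 0 -> forall l, (l < N)%N -> x l = 0.
Proof.
elim: N x => [//|N IH] x Kx; rewrite big_ord_recr /= => x0.
have xlt l : (l < N)%N -> x l = 0.
  move=> lN; have : (q ^- l - q ^- N) *: x l = 0.
    apply: (IH (fun l => (q ^- l - q ^- N) *: x l)) => //.
      by move=> i; rewrite linearZ /= Kx !scalerA mulrC.
    have := congr1 K x0; rewrite raddf0 raddfD raddf_sum /= Kx.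
    under eq_bigr do rewrite Kx; move=> Kx0.
    have := congr1 (fun z => q ^- N *: z) x0; rewrite scalerDr scaler0 -{2}Kx0.
    move=> /addIr; rewrite scaler_sumr => e.
    under eq_bigr do rewrite scalerBl.
    by rewrite sumrB -e subrr.
  move=> /eqP; rewrite scaler_eq0 => /orP[|/eqP//].
  rewrite subr_eq0 !exprnN => /eqP/qexp_inj e.
  by exfalso; move: e; lia.
move=> l; rewrite ltnS leq_eqVlt => /orP[/eqP->|/xlt//].
by move: x0; rewrite big1 ?add0r// => i _; apply: xlt.
Qed.

(** Let [M] be the largest position that occurs. [F^M] kills the terms at
lower positions and multiplies the lowest vectors at position [M] by nonzero
constants. These have different weights for different [l], so each is zero. *)
Lemma strings_independent N u : (forall l j, prim l (u l j)) ->
  vanishes_off N u -> dsum N (fun l j => Ediv j (u l j)) = 0 ->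
  forall l j, u l j = 0.
Proof.
move=> pu u0 e.
suff H M : \sum_(j < M) \sum_(l < N) Ediv j (u l j) = 0 ->
    forall j, (j < M)%N -> forall l, (l < N)%N -> u l j = 0.
  move=> l j; have [/andP[jl lN]|/u0//] := boolP (j <= l < N)%N.
  by apply: (H N) => //; lia.
elim: M => [//|M IH]; rewrite big_ord_recr /= => e0.
have iterF_sum n P (f : 'I_P -> V) :
    iter n F (\sum_(i < P) f i) = \sum_(i < P) iter n F (f i).
  by apply: (big_morph _ (iterFD n) (iterF0 n)).
have uM l : (l < N)%N -> u l M = 0.
  have := congr1 (iter M F) e0; rewrite iterF0 iterFD !iterF_sum big1 ?add0r; last first.
    by move=> j _; rewrite iterF_sum big1// => i _; apply: iterF_Ediv0.
  under eq_bigr do rewrite (iterF_Ediv M (pu _ _)).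
  pose x l := (\prod_(i < M) qint (l%:Z - i%:Z)) *: u l M.
  move=> /(@K_independent N x) H lN.
  have : x l = 0.
    apply: H => // i; rewrite /x linearZ /=; have [_ ->] := pu i M.
    by rewrite !scalerA mulrC.
  have [Ml|lM] := leqP M l; last by move=> _; apply: u0; lia.
  move=> /eqP; rewrite scaler_eq0 => /orP[|/eqP//].
  move=> /prodf_eq0[i _]; rewrite (negPf (qint_neq0 _))//.
  by have := ltn_ord i; lia.
move=> j; rewrite ltnS leq_eqVlt => /orP[/eqP-> //|]; apply: IH.
by move: e0; rewrite [X in _ + X]big1 ?addr0// => l _; rewrite uM ?raddf0.
Qed.

Lemma sigma_graph_fun x y y' : sigma_graph x y -> sigma_graph x y' -> y = y'.
Proof.
move=> gxy gxy'; apply/eqP; rewrite -subr_eq0; apply/eqP.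
have : sigma_graph 0 (y - y').
  have := sigma_graphP (-1) gxy' gxy.
  by rewrite !scaleN1r ![- _ + _]addrC subrr.
move=> [N [u [pu u0 /esym e ->]]]; rewrite /dsum big1// => j _.
by rewrite big1// => l _; rewrite (strings_independent pu u0 e) raddf0.
Qed.

Definition string_flip (g : V -> V) := forall l j u, (j <= l)%N -> prim l u ->
  g (Ediv j u) = Ediv (l - j) u.

Lemma string_flip_exists : exists2 g : V -> V, linear g & string_flip g.
Proof.
have [g gP] := choice sigma_graph_total.
exists g.
  move=> r x y; apply: sigma_graph_fun (gP _) _.
  exact: sigma_graphP.
by move=> l j u jl pu; apply: sigma_graph_fun (gP _) (sigma_graph_Ediv pu jl).
Qed.

Lemma string_flipK (g : {linear V -> V}) : string_flip g -> involutive g.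
Proof.
move=> flip; apply: wt_span => [|x y gx gy|m v /wt_strings].
- by rewrite !raddf0.
- by rewrite !raddfD /= gx gy.
elim=> [|x y _ gx _ gy|l j u pu jl _].
- by rewrite !raddf0.
- by rewrite !raddfD /= gx gy.
- by rewrite (flip l)// (flip l) ?leq_subr// subKn.
Qed.

(** [L] maps [E^(j) u] to [r^j E^(j) (L u)], where [L u] is again a lowest
vector of weight [-l], so moving [L] past the flip costs [r^(l - 2j)], and
[2j - l] is the weight. *)
Lemma string_flip_twist (g L : {linear V -> V}) (r : k) m v : string_flip g ->
  r != 0 ->
  (forall v, L (E v) = r *: E (L v)) -> (forall v, L (F v) = r^-1 *: F (L v)) ->
  (forall v, L (K v) = K (L v)) ->
  wt m v -> L (g v) = r ^ (- m) *: g (L v).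
Proof.
move=> flip r0 LE LF LK /wt_strings; elim=> [|x y _ gx _ gy|l j u pu jl ->].
- by rewrite [g 0]raddf0 [L 0]raddf0 [g 0]raddf0 scaler0.
- by rewrite [g (x + y)]raddfD [L (x + y)]raddfD !raddfD /= gx gy -scalerDr.
have LEdiv n x : L (Ediv n x) = r ^+ n *: Ediv n (L x).
  rewrite /Ediv linearZ /= scalerA mulrC -scalerA; congr (_ *: _).
  elim: n => [|n IH]; first by rewrite scale1r.
  by rewrite /= LE IH linearZ /= scalerA -exprS.
have pLu : prim l (L u).
  have [Fu Ku] := pu; split; last by rewrite -LK Ku linearZ.
  have /eqP := LF u; rewrite Fu raddf0 eq_sym scaler_eq0 invr_eq0 (negPf r0).
  by move=> /eqP.
rewrite (flip l)// LEdiv LEdiv [g (_ *: _)]linearZ /= (flip l)//.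
rewrite [RHS]scalerA; congr (_ *: _).
by rewrite !exprnP -expfzDr//; congr (_ ^ _); lia.
Qed.

End QuantumSl2.

(** * Groups generated by involutions *)

Section Words.
Variables (I : Type) (G : groupType) (s : I -> G).

Definition word_prod (w : seq I) : G := foldr (fun i g => s i * g)%g 1%g w.

Lemma word_prod_cat w w' : word_prod (w ++ w') = (word_prod w * word_prod w')%g.
Proof. by elim: w => [|i w IH] /=; rewrite ?mul1g// IH mulgA. Qed.

Hypothesis s_inv : forall i, (s i * s i = 1)%g.

Lemma word_prod_rev w : word_prod (rev w) = (word_prod w)^-1%g.
Proof.
elim: w => [|i w IH]; first by rewrite /= invg1.
rewrite rev_cons -cats1 word_prod_cat IH /= mulg1 invgM; congr (_ * _)%g.
by rewrite -[LHS]mul1g -(mulVg (s i)) -mulgA s_inv mulg1.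
Qed.

Lemma generated_word x : in_generated s x -> exists w, x = word_prod w.
Proof.
pose H : set G := fun x => exists w, x = word_prod w.
move=> /asboolP/(_ H); apply.
- by exists [::].
- by move=> y z [v ->] [w ->]; exists (v ++ rev w); rewrite word_prod_cat word_prod_rev.
- by move=> i; exists [:: i]; rewrite /= mulg1.
Qed.

End Words.

(** * Transcendental elements *)

(* [ratr] is additive only in characteristic zero, so the images of the explicit
   polynomials in the next two lemmas are computed coefficient by coefficient. *)
Lemma transcendental_neq0 (k : fieldType) (x : k) :
  ~ algebraicOver (@ratr k) x -> x != 0.
Proof.
move=> tr; apply/eqP => x0; apply: tr; exists 'X; first by rewrite polyX_eq0.
have -> : map_poly (@ratr k) 'X = 'X.
  apply/polyP => n; rewrite coef_map_id0 ?ratr_nat ?coefX//; last exact: (ratr_nat _ 0).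
  exact: ratr_nat.
by rewrite rootE hornerX x0.
Qed.

Lemma transcendental_not_root_of_unity (k : fieldType) (x : k) :
  ~ algebraicOver (@ratr k) x -> forall n, (0 < n)%N -> x ^+ n != 1.
Proof.
move=> tr n n0; apply/eqP => xn; apply: tr; exists ('X^n - 1).
  by rewrite -size_poly_eq0 size_XnsubC.
have -> : map_poly (@ratr k) ('X^n - 1) = 'X^n - 1.
  apply/polyP => j; rewrite coef_map_id0; last exact: (ratr_nat _ 0).
  rewrite !coefB !coefXn !coef1.
  have r m : ratr (- m%:R) = - m%:R :> k.
    by have := @ratr_int k (- m%:Z); rewrite !intrN -!pmulrn.
  case: (j == n); case: (j == 0%N); rewrite ?subrr ?subr0 ?sub0r.
  - exact: (ratr_nat _ 0).
  - exact: (ratr_nat _ 1).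
  - exact: (r 1%N).
  - exact: (ratr_nat _ 0).
by rewrite rootE !hornerE xn subrr.
Qed.

(** * Modules over the quantum group *)

HB.instance Definition _ (K : pzRingType) (V : lmodType K) (f : GL V) :=
  GRing.isLinear.Build K V V *:%R (GL_fun f) (GL_linear f).

Section QuantumGroupModules.
Variables (C : numFieldType) (I : finType) (D : root_datum C I).

Local Notation P := (weight_lattice D).

Lemma root_formD (x y z : dual_space D) :
  root_form (x + y) z = root_form x z + root_form y z.
Proof. by have := root_form_linear z 1 x y; rewrite !scale1r. Qed.

Lemma root_formZ r (x z : dual_space D) :
  root_form (r *: x) z = r * root_form x z.
Proof.
have := root_form_linear z r x 0; rewrite addr0 => ->.
have := root_formD 0 0 z; rewrite addr0 -{1}[root_form 0 z]addr0 => /addrI <-.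
by rewrite addr0.
Qed.

Lemma root_formDr (x y z : dual_space D) :
  root_form z (x + y) = root_form z x + root_form z y.
Proof. by rewrite ![root_form z _]root_form_sym root_formD. Qed.

Lemma root_formZr r (x z : dual_space D) :
  root_form z (r *: x) = r * root_form z x.
Proof. by rewrite ![root_form z _]root_form_sym root_formZ. Qed.

Lemma half_form_int (lam : half_lattice D) (beta : dual_space D) : P beta ->
  exists n : int, n%:~R = (2 * root_denom D)%:R * root_form (half_val lam) beta.
Proof.
move=> Pb; have Pl : P (half_val lam *+ 2) by apply/asboolP; case: lam.
have [n e] := root_form_lattice Pl Pb; exists n; rewrite -e.
by rewrite mulr2n root_formD natrM; ring.
Qed.

Lemma weight_latticeB (x y : dual_space D) : P x -> P y -> P (x - y).
Proof.
move=> Px Py; have [_ PB] := weight_lattice_zmod D.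
by apply/asboolP; apply: PB; apply/asboolP.
Qed.

Lemma weight_lattice0 : P 0.
Proof. by have [P0 _] := weight_lattice_zmod D; apply/asboolP. Qed.

Lemma weight_latticeMz (x : dual_space D) (m : int) : P x -> P (x *~ m).
Proof.
move=> Px; have PN y : P y -> P (- y).
  by move=> Py; rewrite -[- y]add0r; apply: weight_latticeB weight_lattice0 Py.
have Pn n : P (x *+ n).
  elim: n => [|n IH]; first exact: weight_lattice0.
  by rewrite mulrSr -[X in _ + X]opprK; apply: weight_latticeB => //; apply: PN.
by case: m => n; [apply: Pn|rewrite NegzE mulrNz; apply/PN/Pn].
Qed.

Variables (k : fieldType) (qr : k).
Hypothesis qr_neq0 : qr != 0.
Hypothesis qr_inf : forall n, (0 < n)%N -> qr ^+ n != 1.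

(** The exponents are well defined because integers embed in [C]. *)
Lemma q_powE (z : C) (n : int) : n%:~R = (2 * root_denom D)%:R * z ->
  q_pow D qr z = qr ^ n.
Proof.
move=> e; rewrite /q_pow; congr (_ ^ _).
by apply: xget_unique => // m /=; rewrite -e => /intr_inj.
Qed.

Lemma q_pow_form (lam : half_lattice D) (x y : dual_space D) m : P x -> P y ->
  q_pow D qr (root_form (half_val lam) (x + y *~ m)) =
  q_pow D qr (root_form (half_val lam) x) *
  q_pow D qr (root_form (half_val lam) y) ^ m.
Proof.
move=> Px Py; have [n e] := half_form_int lam Px.
have [n' e'] := half_form_int lam Py.
rewrite (q_powE e) (q_powE e') exprz_exp -expfzDr//; apply: q_powE.
rewrite root_formDr -scaler_int root_formZr mulrDr -e intrD intrM e'.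
by rewrite mulrCA mulrC mulrA.
Qed.

Lemma q_pow_formN (lam : half_lattice D) (x : dual_space D) : P x ->
  q_pow D qr (- root_form (half_val lam) x) =
  (q_pow D qr (root_form (half_val lam) x))^-1.
Proof.
move=> Px; have [n e] := half_form_int lam Px.
by rewrite (q_powE e) invr_expz; apply: q_powE; rewrite mulrN -e intrN.
Qed.

Lemma q_pow_neq0 z : q_pow D qr z != 0.
Proof. by rewrite /q_pow expfz_neq0. Qed.

(** [(alpha_i, beta)] is the pairing of [beta] with the coroot times
[(alpha_i, alpha_i) / 2], so on a weight vector [K_i] acts by the power of [q_i]
given by that pairing. *)
Lemma q_simpleE i : exists2 n : nat, (0 < n)%N &
  q_simple D qr i = qr ^+ n /\
  forall (beta : dual_space D) (m : int), beta (simple_coroot D i) = m%:~R ->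
  q_pow D qr (root_form (half_val (half_root D i)) beta) = q_simple D qr i ^ m.
Proof.
have [n n0 e] := root_form_simple D i.
exists (2 * root_denom D * n)%N; first by rewrite !muln_gt0 root_denom_gt0.
have qi : q_simple D qr i = qr ^+ (2 * root_denom D * n).
  rewrite /q_simple exprnP; apply: q_powE.
  by rewrite e !natrM -pmulrn !natrM; field.
split=> // beta m bm; rewrite qi exprnP exprz_exp; apply: q_powE.
have := weight_coroot beta i; rewrite bm e => me.
rewrite [half_val _]/= root_form_sym.
have -> : root_form beta (simple_root D i) = m%:~R * n%:R.
  by rewrite me natrM; field; rewrite !pnatr_eq0 -lt0n n0.
by rewrite intrM -pmulrn !natrM; ring.
Qed.

Lemma q_simple_neq0 i : q_simple D qr i != 0.
Proof. exact: q_pow_neq0. Qed.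

Lemma q_simple_inf i n : (0 < n)%N -> q_simple D qr i ^+ n != 1.
Proof.
move=> n0; have [m m0 [-> _]] := q_simpleE i.
by rewrite -exprM; apply: qr_inf; rewrite muln_gt0 m0.
Qed.

Lemma q_pow_half_root i (beta : dual_space D) m :
  beta (simple_coroot D i) = m%:~R ->
  q_pow D qr (root_form (half_val (half_root D i)) beta) = q_simple D qr i ^ m.
Proof. by have [_ _ [_]] := q_simpleE i; apply. Qed.

Local Notation UE := (@Uq_E C I D k qr).
Local Notation UF := (@Uq_F C I D k qr).
Local Notation UK := (@Uq_K C I D k qr).

Lemma Uq_KD lam mu : UK lam * UK mu = UK (lam + mu).
Proof. by have /pcls_eq := pc_rel (@rel_KK C I D k qr lam mu); rewrite pcls_mul. Qed.

Lemma Uq_K0 : UK 0 = 1.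
Proof. exact/pcls_eq/pc_rel/rel_K0. Qed.

Lemma Uq_KE lam i : UK lam * UE i =
  q_pow D qr (root_form (half_val lam) (simple_root D i)) *: (UE i * UK lam).
Proof. by have /pcls_eq := pc_rel (@rel_KE C I D k qr lam i); rewrite !pcls_mul. Qed.

Lemma Uq_KF lam i : UK lam * UF i =
  (q_pow D qr (root_form (half_val lam) (simple_root D i)))^-1 *: (UF i * UK lam).
Proof.
rewrite -q_pow_formN; last exact: simple_root_lattice.
by have /pcls_eq := pc_rel (@rel_KF C I D k qr lam i); rewrite !pcls_mul.
Qed.

Lemma Uq_EF i : UE i * UF i - UF i * UE i =
  (q_simple D qr i - (q_simple D qr i)^-1)^-1 *:
     (UK (half_root D i) - UK (- half_root D i)).
Proof.
have /pcls_eq := pc_rel (@rel_EF C I D k qr i i); rewrite eqxx.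
by rewrite !(pcls_mul, pcls_add).
Qed.

Variable V : lmodType (Uq D qr).
Local Notation W := (restrict_scalars V).
Local Notation wspace := (@weight_space C I D k qr V).

Definition Uq_act (u : Uq D qr) (v : W) : W := u *: (v : V).

Lemma Uq_act_linear u : linear (Uq_act u).
Proof.
move=> r v w; rewrite /Uq_act scalerDr; congr (_ + _).
have -> : r *: v = (r%:A : Uq D qr) *: (v : V) :> V by [].
by rewrite [RHS]scalerA scalerA mulr_algl mulr_algr.
Qed.

HB.instance Definition _ u :=
  GRing.isLinear.Build k W W *:%R (Uq_act u) (Uq_act_linear u).

Lemma Uq_actM u u' v : Uq_act (u * u') v = Uq_act u (Uq_act u' v).
Proof. by rewrite /Uq_act scalerA. Qed.

Lemma Uq_actB u u' v : Uq_act (u - u') v = Uq_act u v - Uq_act u' v.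
Proof. exact: (scalerBl u u' (v : V)). Qed.

Lemma Uq_act1 v : Uq_act 1 v = v.
Proof. exact: (scale1r (v : V)). Qed.

Lemma Uq_actZ r u v : Uq_act (r *: u) v = r *: Uq_act u v.
Proof. by rewrite /Uq_act [RHS]scalerA mulr_algl. Qed.

Lemma iter_Uq_act n u v : iter n (Uq_act u) v = Uq_act (u ^+ n) v.
Proof.
elim: n => [|n IH]; first by rewrite expr0 Uq_act1.
by rewrite iterS IH exprS Uq_actM.
Qed.

Hypothesis V_O_int : in_O_int V.

Section OneRoot.
Variable i : I.
Local Notation q := (q_simple D qr i).
Local Notation E := (Uq_act (UE i)).
Local Notation F := (Uq_act (UF i)).
Local Notation K := (Uq_act (UK (half_root D i))).

Lemma root_pairing_diag :
  q_pow D qr (root_form (half_val (half_root D i)) (simple_root D i)) = q ^ 2.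
Proof. by apply: q_pow_half_root; rewrite simple_root_coroot cartan_diag. Qed.

Lemma act_EF m v : wt q K m v -> E (F v) - F (E v) = qint q m *: v.
Proof.
move=> wv; rewrite -!Uq_actM -Uq_actB Uq_EF Uq_actZ Uq_actB.
have -> : Uq_act (UK (- half_root D i)) v = q ^ (- m) *: v.
  have : Uq_act (UK (- half_root D i)) (K v) = v.
    by rewrite -Uq_actM Uq_KD addNr Uq_K0 Uq_act1.
  rewrite wv linearZ /= => {2}<-.
  by rewrite scalerA -expfzDr ?q_simple_neq0// addNr expr0z scale1r.
by rewrite wv -scalerBl scalerA mulrC.
Qed.

Lemma act_KE v : K (E v) = q ^ 2 *: E (K v).
Proof. by rewrite -!Uq_actM Uq_KE Uq_actZ root_pairing_diag. Qed.

Lemma act_KF v : K (F v) = q ^ (-2) *: F (K v).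
Proof. by rewrite -!Uq_actM Uq_KF Uq_actZ root_pairing_diag invr_expz. Qed.

Lemma act_E_nilp v : exists n, iter n E v = 0.
Proof. by have [n e] := O_int_E_nilp V_O_int i v; exists n; rewrite iter_Uq_act. Qed.

Lemma act_F_nilp v : exists n, iter n F v = 0.
Proof. by have [n e] := O_int_F_nilp V_O_int i v; exists n; rewrite iter_Uq_act. Qed.

Lemma weight_space_wt (beta : dual_space D) m v :
  beta (simple_coroot D i) = m%:~R -> wspace beta v -> wt q K m v.
Proof. by move=> bm /(_ (half_root D i)); rewrite (q_pow_half_root bm). Qed.

Lemma act_wt_span (P' : W -> Prop) : P' 0 ->
  (forall x y, P' x -> P' y -> P' (x + y)) ->
  (forall m v, wt q K m v -> P' v) -> forall v, P' v.
Proof.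
move=> P0 PD Pw v; have [s [f [fs ->]]] := O_int_span V_O_int v.
rewrite big_seq; apply: big_ind => // beta /fs[Pb wb].
have [m bm] := weight_coroot_int i Pb.
exact: Pw (weight_space_wt bm wb).
Qed.

Lemma is_sigma_flip (g : W -> W) :
  is_sigma i g <-> string_flip q E F K g.
Proof.
have Ed j u : Ediv q E j u = Uq_Ediv D qr i j *: (u : V).
  by rewrite /Ediv iter_Uq_act -Uq_actZ.
have Kl l (u : W) : (UK (half_root D i) - (q ^- l)%:A) *: (u : V) = 0 <->
    K u = q ^- l *: u.
  by rewrite scalerBl; split=> /eqP e; apply/eqP; move: e; rewrite subr_eq0.
split=> h l j u.
  by move=> jl [Fu /Kl Ku]; rewrite !Ed; apply: h.
by move=> jl Fu /Kl Ku; rewrite -!Ed; apply: h.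
Qed.

(** The flip of the strings for [E_i], [F_i] witnesses that the choice in the
definition of [sigma] is made from a nonempty set. *)
Lemma sigma_is_sigma : is_sigma i (sigma V i).
Proof.
have [g lin_g flip_g] := string_flip_exists (q_simple_neq0 i) (@q_simple_inf i)
  act_EF act_KE act_KF act_E_nilp act_F_nilp act_wt_span.
pose gl : {linear W -> W} := HB.pack g (GRing.isLinear.Build k W W *:%R g lin_g).
have gK : involutive g :=
  @string_flipK _ _ _ _ _ _ (q_simple_neq0 i) (@q_simple_inf i)
  act_EF act_KE act_KF act_E_nilp act_F_nilp act_wt_span gl flip_g.
have gGL : `[< linear g /\ bijective g >] by apply/asboolP; split=> //; exists g.
apply: (@xgetPex _ _ [set g : GL W | is_sigma i g]).
by exists (MkGL gGL) => /=; apply/is_sigma_flip.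
Qed.

Lemma sigma_inv : (sigma V i * sigma V i)%g = 1%g.
Proof.
apply: GL_eq => v /=.
have flip := (is_sigma_flip _).1 sigma_is_sigma.
exact: (@string_flipK _ _ _ _ _ _ (q_simple_neq0 i) (@q_simple_inf i)
  act_EF act_KE act_KF act_E_nilp act_F_nilp act_wt_span _ flip).
Qed.

Lemma reflection_lattice (beta : dual_space D) : P beta -> P (reflection_fun i beta).
Proof.
move=> Pb; have [m bm] := weight_coroot_int i Pb.
rewrite /reflection_fun bm scaler_int; apply: weight_latticeB => //.
by apply: weight_latticeMz; apply: simple_root_lattice.
Qed.

(** The case [L = K_lambda] of [string_flip_twist], for all [lambda]: the
factor [q^(-m (lambda, alpha_i))], with [m] the pairing of [beta] with the
coroot, accounts for the difference between the weights [beta] and [s_i beta]. *)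
Lemma sigma_weight (beta : dual_space D) (v : W) : P beta -> wspace beta v ->
  wspace (reflection_fun i beta) (sigma V i v).
Proof.
move=> Pb wv lam; have [m bm] := weight_coroot_int i Pb.
have Pa := simple_root_lattice D i.
have flip := (is_sigma_flip _).1 sigma_is_sigma.
have KK (w : W) : Uq_act (UK lam) (K w) = K (Uq_act (UK lam) w).
  by rewrite -!Uq_actM !Uq_KD addrC.
have KE (w : W) : Uq_act (UK lam) (E w) =
    q_pow D qr (root_form (half_val lam) (simple_root D i)) *: E (Uq_act (UK lam) w).
  by rewrite -!Uq_actM Uq_KE Uq_actZ.
have KF (w : W) : Uq_act (UK lam) (F w) =
    (q_pow D qr (root_form (half_val lam) (simple_root D i)))^-1 *: F (Uq_act (UK lam) w).
  by rewrite -!Uq_actM Uq_KF Uq_actZ.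
have e : Uq_act (UK lam) (sigma V i v) =
    q_pow D qr (root_form (half_val lam) (simple_root D i)) ^ (- m) *:
      sigma V i (Uq_act (UK lam) v).
  exact: (@string_flip_twist _ _ _ _ _ _ (q_simple_neq0 i) (@q_simple_inf i)
    act_EF act_KE act_KF act_E_nilp act_F_nilp _ (Uq_act (UK lam)) _ m v flip
    (q_pow_neq0 _) KE KF KK (weight_space_wt bm wv)).
rewrite -[LHS]/(Uq_act (UK lam) (sigma V i v)) e.
have -> : Uq_act (UK lam) v = q_pow D qr (root_form (half_val lam) beta) *: v.
  exact: wv.
rewrite linearZ /= scalerA; congr (_ *: _).
rewrite /reflection_fun bm scaler_int -mulrNz q_pow_form//.
by rewrite mulrC.
Qed.

Lemma act_F_weight (beta : dual_space D) (v : W) : wspace beta v -> P beta ->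
  wspace (beta - simple_root D i : dual_space D) (F v).
Proof.
move=> wv Pb lam; rewrite -[LHS]/(Uq_act (UK lam) (F v)) -Uq_actM Uq_KF Uq_actZ Uq_actM.
have -> : Uq_act (UK lam) v = q_pow D qr (root_form (half_val lam) beta) *: v.
  exact: wv.
rewrite linearZ /= scalerA; congr (_ *: _).
have -> : (beta - simple_root D i : dual_space D) =
    beta + (simple_root D i : dual_space D) *~ (-1) by rewrite mulrN1z.
rewrite q_pow_form//; last exact: simple_root_lattice.
by rewrite mulrC -invr_expz expr1z.
Qed.

(** If [F_i] acts by zero, [E_i F_i - F_i E_i] gives [(m)_q v = 0], where [m] is
the pairing of [beta] with the coroot of [i]. *)
Lemma reflection_fix (beta : dual_space D) (v : W) : i \in J_set V -> P beta ->
  wspace beta v -> v != 0 -> reflection_fun i beta = beta.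
Proof.
rewrite inE => /asboolP F0 Pb wv v0; have [m bm] := weight_coroot_int i Pb.
have := act_EF (weight_space_wt bm wv).
rewrite [F v]F0 [F (E v)]F0 raddf0 subr0 => /esym/eqP.
rewrite scaler_eq0 (negPf v0) orbF => m0; rewrite /reflection_fun bm.
have [->|/(@qint_neq0 _ _ (q_simple_neq0 i) (@q_simple_inf i))] := eqVneq m 0.
  by rewrite scale0r subr0.
by rewrite m0.
Qed.

End OneRoot.

Lemma weight_space_inj (beta gamma : dual_space D) (v : V) : P beta -> P gamma ->
  wspace beta v -> wspace gamma v -> v != 0 -> beta = gamma.
Proof.
move=> Pb Pg wb wg v0; apply/eqP/negPn/negP => bg.
case/negP: v0; apply/eqP.
have := @O_int_direct _ _ _ _ _ _ V_O_int [:: beta; gamma]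
  (fun x => if x == beta then v else - v).
have gb : gamma == beta = false by rewrite eq_sym (negPf bg).
rewrite /= inE bg /= big_cons big_seq1 eqxx gb subrr => /(_ isT) H.
have := H _ erefl beta; rewrite eqxx inE eqxx; apply=> //.
move=> x; rewrite !inE => /orP[/eqP->|/eqP->]; rewrite ?eqxx ?gb; split=> //.
by move=> lam; rewrite !scalerN wg.
Qed.

(* From here on, words are read in the Weyl group after erasing the letters of
   [J(V)], so the theory of reflections is applied to the subset of the simple
   roots indexed by the complement of [J(V)]. *)
Let letter := {i : I | i \notin J_set V}.
Let root (t : letter) : dual_space D := simple_root D (val t).
Let coroot (t : letter) (lam : dual_space D) : C := lam (simple_coroot D (val t)).
Let letters (w : seq I) : seq letter := pmap insub w.

(** Erasing the letters of [J(V)] is harmless, because their reflections fix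
each weight that is met along the word; if the vector has become zero, there is
nothing to check. *)
Lemma sigma_word_weight (w : seq I) (beta : dual_space D) (v : W) :
  P beta -> wspace beta v ->
  P (act root coroot (letters w) beta) /\
  wspace (act root coroot (letters w) beta) ((word_prod (sigma V) w : GL W) v).
Proof.
move=> Pb wv; elim: w => [//|i w [Pw ww]]; rewrite /letters /=.
set gamma := act _ _ _ _ in Pw ww; set u := (word_prod _ _ : GL W) _ in ww.
case: insubP => [t _ ti|]; rewrite /oapp /= -/(letters w) -/gamma.
  have -> : refl root coroot t gamma = reflection_fun i gamma by rewrite -ti.
  by split; [exact: reflection_lattice|exact: sigma_weight].
rewrite negbK => Ji; split=> //; change (wspace gamma (sigma V i u)).
have [->|u0] := eqVneq u 0.
  by rewrite raddf0 => lam; rewrite !scaler0.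
by rewrite -{1}(reflection_fix Ji Pw ww u0); apply: sigma_weight.
Qed.

(** So [beta] and [beta - alpha_i] are weights of [V] when [i] is outside
[J(V)]. *)
Lemma letter_root_moves (t : letter) : exists beta : dual_space D, exists v : W,
  [/\ P beta, wspace beta v, v != 0 & Uq_act (UF (val t)) v != 0].
Proof.
have := valP t; rewrite inE => /asboolPn/existsNP[v /eqP Fv].
have [s [f [fs ve]]] := O_int_span V_O_int v.
have [[beta bs Fb]|none] :=
  pselect (exists2 beta, beta \in s & UF (val t) *: f beta != 0).
  have [Pb wb] := fs _ bs; exists beta, (f beta); split=> //.
  by apply: contraNneq Fb => ->; rewrite scaler0.
case/negP: Fv; rewrite ve scaler_sumr big_seq big1// => beta bs.
by apply/eqP/negPn/negP => h; apply: none; exists beta.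
Qed.

(** The coordinate on [alpha_t] is nonnegative on the cone and equals [-1] at
[- alpha_t]. *)
Lemma roots_pointed (t : letter) : ~ in_cone root (- root t).
Proof.
move=> [s e].
pose X := in_tuple [seq simple_root D i | i : I].
have freeX : free X := simple_root_free D.
have rootX i : simple_root D i = X`_(enum_rank i).
  by rewrite /= nth_image enum_rankK.
have Xsize : (size [seq simple_root D i | i : I] = #|I|)%N by rewrite size_image.
pose j := cast_ord (esym Xsize) (enum_rank (val t)).
have crd i : coord X j (simple_root D i) = (i == val t)%:R.
  rewrite rootX -[enum_rank i : nat]/(cast_ord (esym Xsize) (enum_rank i) : nat).
  rewrite coord_free// -val_eqE /= val_eqE (inj_eq enum_rank_inj).
  by rewrite eq_sym.
have := congr1 (coord X j) e; rewrite raddfN raddf_sum /= crd eqxx => e'.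
have : 0 <= -1 :> C.
  by rewrite e'; apply: sumr_ge0 => u _; rewrite crd ler0n.
by rewrite oppr_ge0 ler10.
Qed.

(** The erased word fixes all weights, hence all differences of weights, hence
all the simple roots outside [J(V)]; this suffices by [act_trivial]. *)
Lemma trivial_sigma_word (w : seq I) :
  word_prod (sigma V) w = 1%g -> forall lam, act root coroot (letters w) lam = lam.
Proof.
move=> w1.
have fix_weight (beta : dual_space D) (v : W) : P beta -> wspace beta v -> v != 0 ->
    act root coroot (letters w) beta = beta.
  move=> Pb wb v0; have [Pw] := sigma_word_weight w Pb wb.
  by rewrite w1 => ww; apply: weight_space_inj Pw Pb ww wb v0.
have coroot_lin t : scalar (coroot t).
  by move=> r x y; rewrite /coroot add_lfunE scale_lfunE.
apply: (@act_trivial _ _ _ root coroot (fun s t => cartan D (val s) (val t))).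
- exact: coroot_lin.
- by move=> s t; apply: simple_root_coroot.
- by move=> s; apply: cartan_diag.
- by move=> s t st; apply: cartan_off.
- by move=> s t; apply: cartan_zero.
- exact: roots_pointed.
move=> t; have [beta [v [Pb wb v0 Fv0]]] := letter_root_moves t.
have wF := act_F_weight (val t) wb Pb.
have PF := weight_latticeB Pb (simple_root_lattice D (val t)).
have := fix_weight _ _ PF wF Fv0.
rewrite (actD root coroot_lin) (actN root coroot_lin) (fix_weight _ _ Pb wb v0).
by move=> /addrI/oppr_inj.
Qed.

(** Send a group element to the product of the images of the letters of a word
chosen for it. The choice does not matter: two words with the same value differ
by a relation [w (rev w')], the reversal being the inverse since the generators
are involutions. *)
Lemma sigma_to_weyl : exists psi : {multiplicative sigma_group V -> weyl_group D},
  forall i : I, psi (generator (sigma V) i) =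
    if i \in J_set V then 1%g else generator (simple_reflection D) i.
Proof.
pose sbar i : weyl_group D :=
  if i \in J_set V then 1%g else generator (simple_reflection D) i.
have sbar_inv i : (sbar i * sbar i)%g = 1%g.
  rewrite /sbar; case: ifP => _; first by rewrite mulg1.
  apply/val_inj/GL_eq => lam /=.
  have := @reflK _ _ _ (fun i => simple_root D i : dual_space D)
    (fun i (lam : dual_space D) => (lam (simple_coroot D i) : C)) (cartan D).
  apply=> [j r x y|s t|s]; first by rewrite add_lfunE scale_lfunE.
    exact: simple_root_coroot.
  exact: cartan_diag.
have sbar_act w lam :
    (val (word_prod sbar w) : GL _) lam = act root coroot (letters w) lam.
  elim: w => [//|i w IH]; rewrite /letters /=.
  rewrite -[LHS]/((val (sbar i) : GL _) ((val (word_prod sbar w) : GL _) lam)) IH /sbar.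
  by case: insubP => [t /negPf-> ti|/negbNE->//]; rewrite -ti.
have key w w' : word_prod (sigma V) w = word_prod (sigma V) w' ->
    word_prod sbar w = word_prod sbar w'.
  move=> e; suff: word_prod sbar (w ++ rev w') = 1%g.
    rewrite word_prod_cat word_prod_rev// => e1.
    by rewrite -[LHS]mulg1 -(mulVg (word_prod sbar w')) mulgA e1 mul1g.
  apply/val_inj/GL_eq => lam; rewrite sbar_act; apply: trivial_sigma_word.
  by rewrite word_prod_cat word_prod_rev ?e ?mulgV//; exact: sigma_inv.
have word (g : sigma_group V) : exists w, val g = word_prod (sigma V) w.
  by have := @generated_word _ _ _ sigma_inv _ (valP g).
have [W0 W0P] := choice word.
pose psi g := word_prod sbar (W0 g).
have psiM : {morph psi : x y / (x * y)%g}.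
  move=> x y; rewrite /psi -word_prod_cat; apply: key.
  by rewrite -W0P word_prod_cat -!W0P.
pose psiM' : {multiplicative sigma_group V -> weyl_group D} :=
  HB.pack psi (isMultiplicative.Build _ _ psi psiM).
exists psiM' => i.
rewrite -[RHS]/(sbar i) -[RHS]mulg1 -[RHS]/(word_prod sbar [:: i]).
by apply: key; rewrite -W0P /= mulg1.
Qed.

End QuantumGroupModules.

Theorem theorem1p1 (R : realType) (I : finType) (D : root_datum R[i] I)
  (k : fieldType) (qr : k)
  (pchar_k : [pchar k] =i pred0)
  (qr_transcendental : ~ algebraicOver (@ratr k) qr)
  (V : lmodType (Uq D qr)) (V_O_int : in_O_int V)
  (V_neq0 : exists v : V, v != 0) :
  exists psi : {multiplicative sigma_group V -> weyl_group D},
    forall i : I,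
      psi (generator (sigma V) i) =
      if i \in J_set V then 1%g else generator (simple_reflection D) i.
Proof.
apply: sigma_to_weyl => //; first exact: transcendental_neq0.
exact: transcendental_not_root_of_unity.
Qed.
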